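(* Let $\alpha>0$ and let $r\in C(0,+\infty)$ satisfy $r(x)>0$ for all $x>0$, $\int_0^1\frac{d\tau}{r(\tau)}<+\infty$, $\int_1^\infty\frac{d\tau}{r(\tau)}=+\infty$, and $r(z)\le C(z+1)$ for all $z>0$, for some $C>0$. Let the sublevel sets of $a$ be thin at infinity in the sense that for any $c>0$ $$\int_1^{+\infty}1_{\{a<c\}}(y)\frac{1}{r(y)}\,dy<+\infty$$ (e.g. let $\lim_{x\to+\infty}a(x)=+\infty$). Then $T$ is resolvent compact, i.e. has compact resolvent in $X_{0,\alpha}$.
   Context: $X_{0,\alpha}:=L^1(\mathbb{R}_+;(1+x)^\alpha dx)$, $\mathbb{R}_+=(0,+\infty)$. The function $a\in L^1_{loc}(0,+\infty)$ is nonnegative. For $t\ge0$ and $y$ with $\int_0^y\frac{d\tau}{r(\tau)}>t$, $X(y,t)\in(0,y]$ is defined by $\int_{X(y,t)}^y\frac{d\tau}{r(\tau)}=t$. $T$ is the generator of the positive $C_0$-semigroup $(U(t))_{t\ge0}$ on $X_{0,\alpha}$ given by $$(U(t)f)(y)=\chi_{\{\int_0^y\frac{1}{r(\tau)}d\tau>t\}}\,e^{-\int_{X(y,t)}^y\frac{a(p)}{r(p)}dp}\,\frac{r(X(y,t))f(X(y,t))}{r(y)}.$$ *)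

(* Defs.v *)
From mathcomp Require Export all_boot all_order all_algebra.
From mathcomp Require Export all_classical all_reals all_analysis.

Set Implicit Arguments.
Unset Strict Implicit.
Unset Printing Implicit Defensive.

Import Order.TTheory GRing.Theory Num.Theory.
Import numFieldNormedType.Exports.

Local Open Scope classical_set_scope.
Local Open Scope ring_scope.

Section Defs.
Context {R : realType}.
Local Notation mu := (@lebesgue_measure R).

Definition Rpos : set R := `]0, +oo[.

(* The library has no normed structure on L^1 quotiented by a.e. equality.
   Elements of X_{0,alpha} are therefore represented by functions R -> R, of
   which only the restriction to ]0, +oo[ matters; equality in X_{0,alpha} is
   a.e. equality on ]0, +oo[. *)
Definition inX (alpha : R) (f : R -> R) : Prop :=
  mu.-integrable Rpos (fun x => (f x * (1 + x) `^ alpha)%:E).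

Definition normX (alpha : R) (f : R -> R) : \bar R :=
  (\int[mu]_(x in Rpos) (`|f x| * (1 + x) `^ alpha)%:E)%E.

Definition eqX (f g : R -> R) : Prop := ae_eq mu Rpos f g.

Definition cvgX (alpha : R) (u : nat -> R -> R) (v : R -> R) : Prop :=
  normX alpha (u n \- v) @[n --> \oo] --> 0%E.

Section Operators.
(* An unbounded operator G on X_{0,alpha} is given by its graph:
   [G u g] stands for "u is in D(G) and G u = g". *)
Variables (alpha : R) (G : (R -> R) -> (R -> R) -> Prop).

(* [resolvent_graph lam f u]: u is in D(G) and (lam - G) u = f. *)
Definition resolvent_graph (lam : R) (f u : R -> R) : Prop :=
  inX alpha f /\ G u (fun x => lam * u x - f x).

Definition resolvent_set : set R := [set lam |
  [/\ forall f, inX alpha f -> exists u, resolvent_graph lam f u,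
      forall f u v, resolvent_graph lam f u -> resolvent_graph lam f v ->
        eqX u v
    & exists M : R, forall f u, resolvent_graph lam f u ->
        (normX alpha u <= M%:E * normX alpha f)%E]].

Definition compact_operator (S : (R -> R) -> (R -> R) -> Prop) : Prop :=
  forall (f u : nat -> R -> R) (M : R),
    (forall n, inX alpha (f n) /\ (normX alpha (f n) <= M%:E)%E) ->
    (forall n, S (f n) (u n)) ->
    exists phi : nat -> nat, exists v : R -> R,
      [/\ {homo phi : m n / (m < n)%N}, inX alpha v
        & cvgX alpha (u \o phi) v].

Definition compact_resolvent : Prop :=
  resolvent_set !=set0 /\
  forall lam, resolvent_set lam -> compact_operator (resolvent_graph lam).

End Operators.

Definition generator (alpha : R) (U : R -> (R -> R) -> (R -> R))
    (f g : R -> R) : Prop :=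
  [/\ inX alpha f, inX alpha g &
      normX alpha (fun y => t^-1 * (U t f y - f y) - g y) @[t --> 0^'+]
        --> 0%E].

(* int_x^y dtau / r(tau) *)
Definition travel_time (r : R -> R) (x y : R) : \bar R :=
  (\int[mu]_(tau in `]x, y[) ((r tau)^-1)%:E)%E.

(* X(y,t); the default value 0 is only taken when no such point exists. *)
Definition flow (r : R -> R) (y t : R) : R :=
  xget 0 [set x | [/\ 0 < x, x <= y & travel_time r x y = t%:E]].

Definition transport_semigroup (a r : R -> R) (t : R) (f : R -> R) (y : R) : R :=
  if (t%:E < travel_time r 0 y)%E then
    expR (- \int[mu]_(p in `]flow r y t, y[) (a p / r p))
      * (r (flow r y t) * f (flow r y t) / r y)
  else 0.

Definition thin_sublevels (a r : R -> R) : Prop :=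
  forall c : R, 0 < c ->
    (\int[mu]_(y in `]1%R, +oo[) (\1_[set z | a z < c] y * (r y)^-1)%:E < +oo)%E.

End Defs.

(* Main.v *)
From HB Require Import structures.
Require Import Defs.
From mathcomp Require Import measurable_realfun ring lra.

Import Order.TTheory GRing.Theory Num.Theory.
Import numFieldNormedType.Exports.

Local Open Scope classical_set_scope.
Local Open Scope ring_scope.

Set Implicit Arguments.
Unset Strict Implicit.
Unset Printing Implicit Defensive.

(** Let tau(y) be the time needed to travel from 0 to y at speed r.  It is an
    increasing bijection of the half-line ([clock], with inverse [place]).
    Read in the time variable s = tau(y), and multiplied by the Jacobian r and
    by the weight (1 + y)^alpha, a function of X_{0,alpha} becomes a function
    of L^1(0, oo) with the same norm ([L1norm_to_clock]), and U(t) becomes the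
    weighted translation
      k |-> e^(lam t) n(s) / n(s - t) k(s - t),
      n(s) = e^(- lam s) (1 + y)^alpha exp(- int_1^y a / r)
    ([to_clock_transport]).  Since r(z) <= C (z + 1), the weight (1 + y)^alpha
    grows at most like e^(alpha C s) ([clock_growth]); with
    lam = alpha C + 1 the function e^s n(s) is therefore nonincreasing
    ([weight_decaying]).  The rest is about such weights n.

    The resolvent at lam is explicit: V k (s) = n(s) int_0^s k / n
    ([shift_resolvent]), a contraction by the Schur test.  The difference
    quotient of V k along the semigroup is governed by the averages
    n(s) / t int_(s-t)^s k / n.  They converge to k almost everywhere by the
    Lebesgue differentiation theorem and do not increase the norm, hence they
    converge in L^1 (Scheffe's lemma, [avg_cvg]).  So V maps into the
    domain and inverts lam - T on the right ([gen_res]).  It inverts it on the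
    left as well because V commutes with the translations ([gen_unique]).

    V is compact ([res_compact]).  For a bounded sequence k_m >= 0 the
    functions int_0^s k_m / n are nondecreasing and locally bounded, so Helly's
    theorem gives an almost everywhere convergent subsequence, and dominated
    convergence gives convergence in L^1 of bounded intervals.  What remains is
    that no mass escapes to infinity: int_(s > N, s > x) n(s) / n(x) ds tends
    to 0 as N grows, uniformly in x ([weight_tail]).  This is what thinness of
    the sublevel sets provides: beyond a far enough point the time spent in
    {a < c} is at most 1 / c, hence n(s) / n(x) <= exp(1 - (1 + c) (s - x))
    there, whose integral exp(1) / (1 + c) is as small as desired; starting points x
    before that point are dealt with by the decay e^(-(s - x)) alone.

    For another point mu of the resolvent set, mu u - T u = f means
    lam u - T u = f + (lam - mu) u, and u is bounded in terms of f; so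
    compactness at lam gives compactness at mu.

    Finally, if a tends to infinity then {a < c} is bounded, and 1 / r is
    integrable on bounded intervals ([coercive_thin]). *)

(** * Translation invariance of Lebesgue measure *)

Section Tools.
Context {R : realType}.
Local Notation mu := (@lebesgue_measure R).

(** Lebesgue measure is determined by its values on the intervals ]a, b], and
    translation preserves their lengths. *)
Lemma lebesgue_measure_translate (t : R) (A : set R) : measurable A ->
  pushforward mu ((fun x => x - t) : _ -> measurableTypeR R) A = mu A.
Proof.
have mt : measurable_fun [set: R] (fun x : R => x - t) by exact: measurable_funB.
pose phi : measurableTypeR R -> measurableTypeR R := fun x => x - t.
pose phi_m := isMeasurableFun.Build _ _ _ _ phi mt.
pose phi_p : {mfun _ >-> _} := HB.pack phi phi_m.
move=> mA; apply/esym.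
apply: (@lebesgue_measure_unique R (pushforward mu phi_p)) => //= _ [[a b]] _ <-.
rewrite /pushforward.
have -> : phi_p @^-1` `]a, b]%classic = `]a + t, b + t]%classic.
  by apply/seteqP; split => x /=; rewrite !in_itv/= /phi ltrBrDr lerBlDr.
rewrite !lebesgue_measure_itv/= !lte_fin ltrD2r.
by case: ifP => // _; rewrite -!EFinB; congr EFin; ring.
Qed.

Lemma ge0_integral_translate (t : R) (F : R -> \bar R) :
  measurable_fun setT F -> (forall x, 0 <= F x)%E ->
  (\int[mu]_x F (x - t)%R = \int[mu]_x F x)%E.
Proof.
move=> mF F0.
have mt : measurable_fun [set: R] (fun x : R => x - t) by exact: measurable_funB.
have := @ge0_integral_pushforward _ _ (measurableTypeR R) (measurableTypeR R)
  R _ mt mu setT F measurableT mF (fun x _ => F0 x).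
rewrite preimage_setT => <-.
by apply: eq_measure_integral => //= A mA _; exact: lebesgue_measure_translate.
Qed.

Lemma integrable_translate (t : R) (f : R -> R) :
  mu.-integrable setT (EFin \o f) ->
  mu.-integrable setT (EFin \o (fun x => f (x - t))).
Proof.
have mt : measurable_fun [set: R] (fun x : R => x - t) by exact: measurable_funB.
move=> /integrableP[mf fi]; apply/integrableP; split.
  exact: (measurableT_comp mf).
rewrite /=; have := @ge0_integral_translate t (fun x => `|(f x)%:E|%E).
by move=> ->//; exact: measurableT_comp.
Qed.

Lemma Rintegral_translate (t : R) (f : R -> R) :
  mu.-integrable setT (EFin \o f) ->
  \int[mu]_x f (x - t) = \int[mu]_x f x.
Proof.
move=> fi.
have mf : measurable_fun setT f by apply/measurable_EFinP; exact: measurable_int fi.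
have mt : measurable_fun [set: R] (fun x : R => x - t) by exact: measurable_funB.
have [mfp mfn] : measurable_fun setT ((EFin \o f)^\+)%E /\
    measurable_fun setT ((EFin \o f)^\-)%E.
  by split; [apply: measurable_funepos|apply: measurable_funeneg];
    apply/measurable_EFinP.
rewrite /Rintegral [in LHS]integralE [in RHS]integralE.
rewrite -(ge0_integral_translate t mfp); last by [].
rewrite -(ge0_integral_translate t mfn); last by [].
by congr (fine (_ - _)%E); apply: eq_integral => x _; rewrite ?funeposE ?funenegE.
Qed.

End Tools.

(** * Integration against a measure with a density *)

Section density.
Context d (T : measurableType d) (R : realType).
Variables (mu : {measure set T -> \bar R}) (h : T -> R).
Hypothesis mh : measurable_fun setT h.
Hypothesis h0 : forall x, 0 <= h x.

Definition density_measure (A : set T) : \bar R := (\int[mu]_(x in A) (h x)%:E)%E.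

Let density0 : density_measure set0 = 0%E.
Proof. by rewrite /density_measure integral_set0. Qed.

Let density_ge0 A : (0 <= density_measure A)%E.
Proof. by apply: integral_ge0 => x _; rewrite lee_fin. Qed.

Let density_sigma_additive : semi_sigma_additive density_measure.
Proof.
move=> F mF tF mUF; rewrite /density_measure ge0_integral_bigcup//; last first.
- by move=> x _; rewrite lee_fin.
- by apply/measurable_EFinP; exact: measurable_funTS.
apply: is_cvg_ereal_nneg_natsum_cond => n _ _.
by apply: integral_ge0 => x _; rewrite lee_fin.
Qed.

HB.instance Definition _ := isMeasure.Build _ _ _ density_measure
  density0 density_ge0 density_sigma_additive.

Definition density : {measure set T -> \bar R} := density_measure.

Import HBNNSimple.

(** True for simple functions by additivity, hence in general by monotone
    convergence along a simple approximation of f. *)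
Lemma ge0_integral_density (f : T -> \bar R) :
  measurable_fun setT f -> (forall x, 0 <= f x)%E ->
  (\int[density]_x f x = \int[mu]_x (f x * (h x)%:E))%E.
Proof.
move=> mf f0; pose f_ := nnsfun_approx measurableT mf.
have mfh n : measurable_fun [set: T] (fun x => (f_ n x)%:E * (h x)%:E)%E.
  by apply: emeasurable_funM; exact/measurable_EFinP.
have fcvg x : (f_ n x)%:E @[n --> \oo] --> f x by exact: cvg_nnsfun_approx.
transitivity (limn (fun n => \int[density]_x (f_ n x)%:E))%E.
  rewrite -monotone_convergence//.
  - by apply: eq_integral => x _; apply/esym/cvg_lim.
  - by move=> n; exact/measurable_EFinP.
  - by move=> n x _; rewrite lee_fin.
  - by move=> x _ m n mn; rewrite lee_fin; exact/lefP/nd_nnsfun_approx.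
transitivity (limn (fun n => \int[mu]_x ((f_ n x)%:E * (h x)%:E)))%E; last first.
  rewrite -monotone_convergence//.
  - apply: eq_integral => x _; apply/cvg_lim => //.
    by apply: cvgeZr.
  - by move=> n x _; rewrite mule_ge0// lee_fin.
  - move=> x _ m n mn; apply: lee_wpmul2r; rewrite ?lee_fin//.
    exact/lefP/nd_nnsfun_approx.
apply: congr_lim; apply/funext => n.
under [LHS]eq_integral do rewrite fimfunE -fsumEFin//.
rewrite ge0_integral_fsum//; last 2 first.
- by move=> y; exact/measurable_EFinP/measurable_funM.
- by move=> y x _; rewrite nnfun_muleindic_ge0.
under [RHS]eq_integral => x _.
  rewrite fimfunE -fsumEFin// muleC ge0_mule_fsumr; last first.
    by move=> y; rewrite nnfun_muleindic_ge0.
  over.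
rewrite ge0_integral_fsum//; last 2 first.
- by move=> y; apply: emeasurable_funM;
    [exact/measurable_EFinP|exact/measurable_EFinP/measurable_funM].
- by move=> y x _; apply: mule_ge0; [rewrite lee_fin|exact: nnfun_muleindic_ge0].
apply: eq_fsbigr => r rf.
have mA : measurable (f_ n @^-1` [set r]) by [].
have r0 : 0 <= r by move: rf; rewrite inE => -[x _ <-].
under eq_integral do rewrite EFinM.
rewrite ge0_integralZl//; last exact/measurable_EFinP.
rewrite integral_indic// setIT.
under [RHS]eq_integral => x _ do rewrite EFinM muleCA.
rewrite ge0_integralZl//; last 2 first.
- by apply: emeasurable_funM; exact/measurable_EFinP.
- by move=> x _; rewrite mule_ge0// lee_fin.
congr (_ * _)%E; rewrite /density/= /density_measure integral_mkcond.
apply: eq_integral => x _; rewrite patchE indicE.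
by case: ifPn => _; rewrite ?mule1 ?mule0.
Qed.

End density.

(** * The Schur test *)

Section Schur.
Context {R : realType}.
Local Notation mu := (@lebesgue_measure R).

(** Exchange the integrals (Tonelli) and bound the inner one.  The bound on the
    columns of K is only asked where k is nonzero, so that kernels which are
    under control on the half-line only can be used. *)
Lemma schur_test (K : R * R -> R) (c : R) (k : R -> R) :
  measurable_fun setT K -> (forall z, 0 <= K z) ->
  measurable_fun setT k -> 0 <= c ->
  (forall x, k x != 0%R -> \int[mu]_s (K (s, x))%:E <= c%:E)%E ->
  (\int[mu]_s \int[mu]_x (K (s, x) * `|k x|)%:E <= c%:E * \int[mu]_x `|k x|%:E)%E.
Proof.
move=> mK K0 mk c0 Kc.
have mKk : measurable_fun setT (fun z : R * R => (K z * `|k z.2|)%:E).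
  apply/measurable_EFinP; apply: measurable_funM => //.
  by apply: measurableT_comp => //; apply: (measurableT_comp mk).
have Kk0 (z : R * R) : (0 <= (K z * `|k z.2|)%:E)%E by rewrite lee_fin mulr_ge0.
have -> : (\int[mu]_s \int[mu]_x (K (s, x) * `|k x|)%:E =
           \int[mu]_x \int[mu]_s (K (s, x) * `|k x|)%:E)%E.
  exact: (@fubini_tonelli _ _ _ _ R mu mu _ mKk Kk0).
have mk' : measurable_fun setT (fun x => (`|k x|)%:E).
  by apply/measurable_EFinP; exact: measurableT_comp.
rewrite -ge0_integralZl//.
apply: ge0_le_integral => //.
- by move=> x _; apply: integral_ge0 => s _; rewrite lee_fin mulr_ge0.
- exact: (@measurable_fun_fubini_tonelli_G _ _ _ _ R mu _ mKk).
- exact: measurable_funeM.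
- move=> x _; rewrite /=; under eq_integral do rewrite EFinM.
  rewrite ge0_integralZr//; last 2 first.
    apply/measurable_EFinP; apply: (measurableT_comp mK).
    exact: measurable_fun_pair.
  by move=> s _; rewrite lee_fin.
  have [->|kx0] := eqVneq (k x) 0; first by rewrite normr0 !mule0.
  by apply: lee_wpmul2r; [rewrite lee_fin|exact: Kc].
Qed.

End Schur.

(** * Helly's selection theorem *)

Section Helly.
Context {R : realType}.
Local Notation mu := (@lebesgue_measure R).

(** A point where the one-sided limits agree can be squeezed between rationals
    over which L varies arbitrarily little: this is what transfers convergence
    from the rationals to such a point. *)
Lemma homo_continuity_gap (L : R -> R) (x : R) : {homo L : y z / y <= z} ->
  ~ discontinuity L x -> forall e, 0 < e ->
  exists q q' : rat, [/\ ratr q < x, x < ratr q' & L (ratr q') - L (ratr q) < e].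
Proof.
move=> Lnd Lx e e0.
have cl : cvg (L y @[y --> x^'-]).
  apply: nondecreasing_at_left_is_cvgr; apply: nearW => z.
    by move=> y y' _ _; exact: Lnd.
  by exists (L x) => _ /= [y + <-]; rewrite in_itv/= => /andP[_ /ltW]; exact: Lnd.
have cr : cvg (L y @[y --> x^'+]).
  apply: nondecreasing_at_right_is_cvgr; apply: nearW => z.
    by move=> y y' _ _; exact: Lnd.
  by exists (L x) => _ /= [y + <-]; rewrite in_itv/= => /andP[/ltW + _]; exact: Lnd.
have lr : lim (L y @[y --> x^'-]) = lim (L y @[y --> x^'+]).
  by apply/eqP/negPn/negP => ne; apply: Lx; split.
set l := lim _ in lr; rewrite -lr in cr.
have e2 : 0 < e / 2 by rewrite divr_gt0.
have /cvgrPdist_lt/(_ _ e2)[d /= d0 Hd] : L y @[y --> x^'-] --> l by exact: cl.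
have /cvgrPdist_lt/(_ _ e2)[d' /= d'0 Hd'] : L y @[y --> x^'+] --> l by exact: cr.
have xd : x - d < x by rewrite ltrBlDr ltrDl.
have xd' : x < x + d' by rewrite ltrDl.
have [q] := rat_in_itvoo xd; rewrite in_itv/= => /andP[q1 q2].
have [q'] := rat_in_itvoo xd'; rewrite in_itv/= => /andP[q'1 q'2].
exists q, q'; split => //.
have h1 := Hd (ratr q); have h2 := Hd' (ratr q').
have {}h1 : `|l - L (ratr q)| < e / 2.
  by apply: h1 => //=; rewrite gtr0_norm ?subr_gt0//; lra.
have {}h2 : `|l - L (ratr q')| < e / 2.
  by apply: h2 => //=; rewrite ltr0_norm ?subr_lt0//; lra.
move: h1 h2; rewrite !ltr_norml => /andP[? ?] /andP[? ?]; lra.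
Qed.

Lemma homo_ae_continuous (L : R -> R) : {homo L : y z / y <= z} ->
  {ae mu, forall x, ~ discontinuity L x}.
Proof.
move=> Lnd.
pose A (N : nat) := [set x : R | x \in (`](- N%:R), N%:R[) /\ discontinuity L x].
have cA : countable (\bigcup_N A N).
  apply: bigcup_countable => // N _; apply: discontinuity_countable.
  by move=> y z _ _; exact: Lnd.
exists (\bigcup_N A N); split.
- exact: countable_measurable.
- exact: countable_lebesgue_measure0.
- move=> x /= /contrapT dx; exists (Num.truncn `|x|).+1 => //=; split => //.
  by rewrite in_itv/= -ltr_norml truncnS_gt.
Qed.

(** By Tychonoff, the sequence has a cluster point L for pointwise
    convergence.  L is monotone; a diagonal extraction makes the convergence
    hold at all rationals; monotonicity extends it to the points where L has no
    jump, and the jumps are countably many. *)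
Lemma helly_selection (H : nat -> R -> R) (B : R -> R) :
  (forall n, {homo H n : x y / x <= y}) -> (forall n x, `|H n x| <= B x) ->
  exists (phi : nat -> nat) (L : R -> R),
    [/\ {homo phi : m n / (m < n)%N}, {homo L : x y / x <= y},
        forall x, `|L x| <= B x
      & {ae mu, forall x, H (phi n) x @[n --> \oo] --> L x}].
Proof.
move=> Hnd HB.
pose T : R -> topologicalType := fun=> R.
pose A := [set f : prod_topology T | forall i, `[- B i, B i]%classic (f i)].
have cA : compact A.
  apply: (@tychonoff R T (fun i => `[- B i, B i]%classic)) => i.
  exact: segment_compact.
pose F : set_system (prod_topology T) := (fun n => H n : prod_topology T) @ \oo.
have FA : F A.
  by exists 0%N => // n _ i /=; rewrite in_itv/= -ler_norml.
have [L [/= LB Lcl]] := cA F _ FA.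
have near1 x e : 0 < e -> nbhs (L : prod_topology T) [set f | `|f x - L x| < e].
  move=> e0; have := @proj_continuous _ T x L.
  move=> /(_ [set y : R | `|y - L x| < e]); apply.
  by apply/nbhs_ballP; exists e => //= y /=; rewrite /ball/= distrC.
have nearS (s : seq R) e : 0 < e ->
    nbhs (L : prod_topology T) [set f | forall x, x \in s -> `|f x - L x| < e].
  move=> e0; elim: s => [|a s IH]; first by apply: filterS filterT => f _ x.
  apply: filterS (filterI (near1 a e e0) IH) => f [/= fa fs] x.
  by rewrite inE => /predU1P[->//|/fs].
(* L is a cluster point: every finite set of values is approached infinitely
   often. *)
have pick (s : seq R) e N : 0 < e ->
    exists m, (N < m)%N /\ forall x, x \in s -> `|H m x - L x| < e.
  move=> e0.
  have FN : F [set f | exists2 m, (N < m)%N & f = H m].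
    by exists N.+1 => // m /= Nm; exists m.
  by have [f [/= [m Nm ->] h]] := Lcl _ _ FN (nearS s e e0); exists m.
have Lnd : {homo L : x y / x <= y}.
  move=> x y xy; apply/ler_addgt0Pr => e e0.
  have e2 : 0 < e / 2 by rewrite divr_gt0.
  have [m [_ h]] := pick [:: x; y] _ 0%N e2.
  have := h x; have := h y; rewrite !inE !eqxx orbT/= => /(_ erefl) h1 /(_ erefl) h2.
  have := Hnd m _ _ xy.
  move: h1 h2; rewrite !ltr_norml => /andP[? ?] /andP[? ?] ?; lra.
(* q enumerates the rationals; phi k is chosen to approximate L within 1 / (k + 1)
   at q 0, ..., q k. *)
pose q i : R := ratr (odflt 0 (unpickle i : option rat)).
have /choice[g Hg] : forall Nk : nat * nat, exists m, (Nk.1 < m)%N /\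
    forall x, x \in [seq q i | i <- iota 0 Nk.2.+1] -> `|H m x - L x| < Nk.2.+1%:R^-1.
  by move=> [N k] /=; apply: pick; rewrite invr_gt0.
pose phi := fix phi k := if k is k'.+1 then g (phi k', k) else g (0%N, 0%N).
have phiP k i : (i <= k)%N -> `|H (phi k) (q i) - L (q i)| < k.+1%:R^-1.
  move=> ik; have mi : q i \in [seq q i | i <- iota 0 k.+1].
    by apply: map_f; rewrite mem_iota.
  by case: k ik mi => [|k] ik mi; apply: (Hg (_, _)).2.
have phiS k : (phi k < phi k.+1)%N by exact: (Hg (phi k, k.+1)).1.
exists phi, L; split => //.
- by apply: homo_ltn => // a b c; exact: ltn_trans.
- by move=> x; have := LB x; rewrite /= in_itv/= -ler_norml.
have Lq (p : rat) : H (phi n) (ratr p) @[n --> \oo] --> L (ratr p).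
  apply/cvgrPdist_lt => e e0.
  have -> : ratr p = q (pickle p) :> R by rewrite /q pickleK.
  near=> n; rewrite distrC; apply: (lt_trans (phiP n (pickle p) _)).
    by near: n; exact: nbhs_infty_ge.
  by near: n; exact: near_infty_natSinv_lt (PosNum e0).
move: (homo_ae_continuous Lnd).
apply: filterS; first exact: (ae_filter_ringOfSetsType mu).
move=> x Lx.
apply/cvgrPdist_lt => e e0.
have e2 : 0 < e / 2 by rewrite divr_gt0.
have [p [p' [px xp' Lpp]]] := homo_continuity_gap Lnd Lx e2.
have [/cvgrPdist_lt/(_ _ e2) c1 /cvgrPdist_lt/(_ _ e2) c2] := (Lq p, Lq p').
near=> n.
have : `|L (ratr p) - H (phi n) (ratr p)| < e / 2 by near: n.
have : `|L (ratr p') - H (phi n) (ratr p')| < e / 2 by near: n.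
have := Hnd (phi n) _ _ (ltW px); have := Hnd (phi n) _ _ (ltW xp').
have := Lnd _ _ (ltW px); have := Lnd _ _ (ltW xp').
rewrite !ltr_norml => ? ? ? ? /andP[? ?] /andP[? ?]; apply/andP; split; lra.
Unshelve. all: by end_near. Qed.

End Helly.

(** * An exponential integral *)

Section Exponential.
Context {R : realType}.
Local Notation mu := (@lebesgue_measure R).

Lemma integral_exp_tail (d a : R) : 0 < d ->
  (\int[mu]_(s in `[a, +oo[) (expR (- (d * (s - a))))%:E = d^-1%:E)%E.
Proof.
move=> d0.
have mp : measurable_fun setT (fun x : R => (exponential_pdf d x)%:E).
  by apply/measurable_EFinP; exact: measurable_exponential_pdf.
have := integral_exponential_pdf d0.
rewrite -(@ge0_integral_translate _ a (fun x => (exponential_pdf d x)%:E))//; last first.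
  by move=> x; rewrite lee_fin exponential_pdf_ge0// ltW.
move=> h; rewrite integral_mkcond.
rewrite (_ : (_ \_ _) = (fun x => d^-1%:E * (exponential_pdf d (x - a))%:E)%E); last first.
  apply/funext => x; rewrite patchE mem_setE in_itv/= andbT; case: ifPn => ax.
    rewrite exponential_pdfE ?subr_ge0// -EFinM mulrA mulVf ?gt_eqF// mul1r.
    by congr (expR _)%:E; ring.
  by rewrite lt0_exponential_pdf ?mule0// subr_lt0 ltNge.
rewrite ge0_integralZl//; first by rewrite h mule1.
- by apply: (measurableT_comp mp); exact: measurable_funB.
- by move=> x _; rewrite lee_fin exponential_pdf_ge0// ltW.
- by rewrite lee_fin invr_ge0 ltW.
Qed.

End Exponential.

(** * Integrable functions carried by the half-line *)

Section L1.
Context {R : realType}.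
Local Notation mu := (@lebesgue_measure R).
Implicit Types k l : R -> R.

Definition L1norm k : \bar R := (\int[mu]_x `|k x|%:E)%E.

(** L^1(0, oo) is realised inside L^1(R), so that integrals over the whole line
    and translations need no bookkeeping of domains. *)
Definition L1pos k : Prop :=
  mu.-integrable setT (EFin \o k) /\ forall x, x <= 0 -> k x = 0.

Lemma L1norm_ge0 k : (0 <= L1norm k)%E.
Proof. by apply: integral_ge0 => x _; rewrite lee_fin. Qed.

Lemma L1pos_measurable k : L1pos k -> measurable_fun setT k.
Proof. by move=> [/measurable_int/measurable_EFinP]. Qed.

Lemma L1norm_lty k : L1pos k -> (L1norm k < +oo)%E.
Proof. by move=> [/integrableP[]]. Qed.

Lemma L1pos_fin k : L1pos k -> L1norm k \is a fin_num.
Proof. by move=> /L1norm_lty; rewrite ge0_fin_numE// L1norm_ge0. Qed.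

Lemma L1posI k : measurable_fun setT k -> (forall x, x <= 0 -> k x = 0) ->
  (L1norm k < +oo)%E -> L1pos k.
Proof.
by move=> mk k0 kfin; split => //; apply/integrableP; split => //; apply/measurable_EFinP.
Qed.

Lemma L1posZ a k : L1pos k -> L1pos (fun x => a * k x).
Proof.
move=> [ki k0]; split; last by move=> x /k0 ->; rewrite mulr0.
by have := integrableZl measurableT a ki.
Qed.

Lemma L1posD k l : L1pos k -> L1pos l -> L1pos (fun x => k x + l x).
Proof.
move=> [ki k0] [li l0]; split; last by move=> x x0; rewrite k0// l0// addr0.
by have := integrableD measurableT ki li.
Qed.

Lemma L1posB k l : L1pos k -> L1pos l -> L1pos (fun x => k x - l x).
Proof.
move=> [ki k0] [li l0]; split; last by move=> x x0; rewrite k0// l0// subr0.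
by have := integrableB measurableT ki li.
Qed.

Lemma L1pos_funrpos k : L1pos k -> L1pos k^\+.
Proof.
move=> [ki k0]; split; first exact: integrable_funrpos.
by move=> x /k0 kx0; rewrite /funrpos kx0 maxxx.
Qed.

Lemma L1pos_funrneg k : L1pos k -> L1pos k^\-.
Proof.
move=> [ki k0]; split; first exact: integrable_funrneg.
by move=> x /k0 kx0; rewrite /funrneg kx0 oppr0 maxxx.
Qed.

Lemma L1norm_funrpos k : measurable_fun setT k -> (L1norm (k^\+)%R <= L1norm k)%E.
Proof.
move=> mk; apply: ge0_le_integral => //.
- by apply/measurable_EFinP; apply: measurableT_comp => //; exact: measurable_funrpos.
- by apply/measurable_EFinP; apply: measurableT_comp.
- move=> x _; rewrite lee_fin ger0_norm ?funrpos_ge0// /funrpos.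
  by rewrite ge_max ler_norm normr_ge0.
Qed.

Lemma L1norm_funrneg k : measurable_fun setT k -> (L1norm (k^\-)%R <= L1norm k)%E.
Proof.
move=> mk; apply: ge0_le_integral => //.
- by apply/measurable_EFinP; apply: measurableT_comp => //; exact: measurable_funrneg.
- by apply/measurable_EFinP; apply: measurableT_comp.
- move=> x _; rewrite lee_fin ger0_norm ?funrneg_ge0// /funrneg.
  by rewrite ge_max -normrN ler_norm normr_ge0.
Qed.

Lemma funr_split k x : k x = k^\+ x - k^\- x.
Proof. by rewrite -[in LHS](funrposBneg k). Qed.

Lemma eq_L1norm k l : k =1 l -> L1norm k = L1norm l.
Proof. by move=> /funext ->. Qed.

Lemma L1norm_triangle k l : measurable_fun setT k -> measurable_fun setT l ->
  (L1norm (fun x => (k x + l x)%R) <= L1norm k + L1norm l)%E.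
Proof.
move=> mk ml; rewrite /L1norm -ge0_integralD//; last 2 first.
- by apply/measurable_EFinP; apply: measurableT_comp.
- by apply/measurable_EFinP; apply: measurableT_comp.
apply: ge0_le_integral => //.
- by apply/measurable_EFinP; apply: measurableT_comp => //; exact: measurable_funD.
- by apply/measurable_EFinP; apply: measurable_funD; apply: measurableT_comp.
- by move=> x _; rewrite -EFinD lee_fin ler_normD.
Qed.

Lemma L1normN k : L1norm (fun x => - k x) = L1norm k.
Proof. by apply: eq_integral => x _; rewrite normrN. Qed.

Lemma L1norm_triangleB k l : measurable_fun setT k -> measurable_fun setT l ->
  (L1norm (fun x => (k x - l x)%R) <= L1norm k + L1norm l)%E.
Proof.
move=> mk ml; rewrite -(L1normN l); apply: L1norm_triangle => //.
exact: measurable_funN.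
Qed.

Lemma L1normZ a k : measurable_fun setT k ->
  L1norm (fun x => a * k x) = (`|a|%:E * L1norm k)%E.
Proof.
move=> mk; rewrite /L1norm -ge0_integralZl//.
- by apply: eq_integral => x _; rewrite normrM EFinM.
- by apply/measurable_EFinP; apply: measurableT_comp.
Qed.

(** From |F - k| = F + k - 2 min(F, k) one gets
    |F - k| + k = F + 2 |min(F, k) - k| pointwise; min(F, k) converges to k in
    L^1 by dominated convergence, and the integral of F does not exceed that of
    k. *)
Lemma scheffe (F : nat -> R -> R) k :
  (forall n, measurable_fun setT (F n)) -> (forall n x, 0 <= F n x) ->
  mu.-integrable setT (EFin \o k) -> (forall x, 0 <= k x) ->
  {ae mu, forall x, F n x @[n --> \oo] --> k x} ->
  (forall n, L1norm (F n) <= L1norm k)%E ->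
  L1norm (fun x => F n x - k x) @[n --> \oo] --> 0%E.
Proof.
move=> mF F0 ki k0 Fk Fle.
have mk : measurable_fun setT k by apply/measurable_EFinP; exact: measurable_int ki.
pose G n x := Num.min (F n x) (k x).
have mG n : measurable_fun setT (G n) by exact: measurable_minr.
have G0 n x : 0 <= G n x by rewrite le_min F0 k0.
have Gk n x : G n x <= k x by rewrite ge_min lexx orbT.
have [_ + _] : [/\ mu.-integrable setT (EFin \o k),
   [sequence \int[mu]_(x in setT) (`|(G n x)%:E - (k x)%:E|)]_n%E @ \oo --> 0%E &
   [sequence \int[mu]_(x in setT) (G n x)%:E]_n%E @ \oo --> (\int[mu]_(x in setT) (k x)%:E)%E].
  apply: (@dominated_convergence _ _ _ mu _ measurableT _ _ (EFin \o k)) => //.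
  - by move=> n; apply/measurable_EFinP; exact: mG.
  - by apply/measurable_EFinP; exact: mk.
  - move: Fk; apply: filterS; first exact: (ae_filter_ringOfSetsType mu).
    move=> x Fx _; apply: cvg_EFin; first by apply: nearW.
    move/cvgrPdist_lt in Fx; apply/cvgrPdist_lt => e /Fx.
    apply: filterS => n; apply: le_lt_trans; rewrite /= /G.
    by have [//|_] := leP (F n x) (k x); rewrite subrr normr0.
  - by apply: aeW => x n _ /=; rewrite lee_fin ger0_norm// Gk.
rewrite /=; set D := (X in X @ _ --> _ -> _) => Dcvg.
have kfin : L1norm k \is a fin_num.
  rewrite ge0_fin_numE; last exact: L1norm_ge0.
  by case/integrableP : ki.
apply: (@squeeze_cvge _ _ _ _ (cst 0%E) _ (fun n => 2%:E * D n)%E).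
- apply: nearW => n; rewrite L1norm_ge0/=.
  have mE (f : R -> R) : measurable_fun setT f ->
      measurable_fun [set: R] (fun x => (`|f x|)%:E).
    by move=> mf; apply/measurable_EFinP; exact: measurableT_comp.
  have mD := mE _ (measurable_funB (mG n) mk).
  have mFk := mE _ (measurable_funB (mF n) mk).
  have mFn := mE _ (mF n).
  have mkn := mE _ mk.
  have DE : D n = (\int[mu]_x `|G n x - k x|%:E)%E by [].
  have key : (L1norm (fun x => F n x - k x)%R + L1norm k <= L1norm (F n) + 2%:E * D n)%E.
    rewrite DE -ge0_integralZl//.
    rewrite /L1norm -ge0_integralD//.
    have mD2 : measurable_fun [set: R] (fun x => 2%:E * (`|G n x - k x|)%:E)%E.
      exact: measurable_funeM.
    rewrite -ge0_integralD//.
    apply: ge0_le_integral => //.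
    - by move=> x _; rewrite adde_ge0.
    - by apply: emeasurable_funD; [exact: mFk|exact: mkn].
    - by apply: emeasurable_funD; [exact: mFn|exact: mD2].
    - move=> x _; rewrite -EFinM -!EFinD lee_fin (ger0_norm (k0 x)) (ger0_norm (F0 n x)).
      rewrite (distrC (G n x)) (ger0_norm (_ : 0 <= k x - G n x)) ?subr_ge0//.
      rewrite /G; have [Fkx|kFx] := leP (F n x) (k x).
        by rewrite ler0_norm ?subr_le0//; lra.
      by rewrite gtr0_norm ?subr_gt0//; lra.
  rewrite -(@leeD2rE _ (L1norm k))//; apply: (le_trans key).
  by rewrite addeC; apply: leeD2l; exact: Fle.
- exact: cvg_cst.
- by rewrite -(mule0 2%:E); apply: cvgeZl.
Qed.

End L1.

(** * Weighted translations *)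

(** The third condition says that e^s n(s) is nonincreasing on the half-line.
    The value 0 on the negative half-line makes 1 / n vanish there as well, which
    turns the cut-off at 0 in the formulas below into an automatic fact. *)
Record decaying_weight {R : realType} (n : R -> R) : Prop := DecayingWeight {
  weight_le0 : forall s, s <= 0 -> n s = 0 ;
  weight_gt0 : forall s, 0 < s -> 0 < n s ;
  weight_decay : forall s t, 0 < s -> s <= t -> n t <= expR (s - t) * n s }.

Section WeightedTranslation.
Context {R : realType}.
Local Notation mu := (@lebesgue_measure R).
Variables (lam : R) (n : R -> R).
Hypothesis wn : decaying_weight n.
Implicit Types k f : R -> R.

(** The factor n s / n (s - t) vanishes unless s > 0 and s > t: it carries the
    cut-off that a shift on the half-line needs. *)
Definition weighted_shift (t : R) k (s : R) : R := expR (lam * t) * (n s / n (s - t)) * k (s - t).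
Definition ratio_prim k (s : R) : R := \int[mu]_(x in `]-oo, s]) (k x / n x).
(** The Laplace transform at lam of the semigroup [weighted_shift lam]. *)
Definition shift_resolvent k (s : R) : R := n s * ratio_prim k s.
(** Equal to n(s) / t times the integral of k / n over ]s - t, s]. *)
Definition window_avg (t : R) k (s : R) : R :=
  t^-1 * (n s * (ratio_prim k s - ratio_prim k (s - t))).

Lemma weight_ge0 s : 0 <= n s.
Proof. by have [/(weight_le0 wn)->|/(weight_gt0 wn)/ltW] := leP s 0. Qed.

Lemma weight_nonincr s t : 0 < s -> s <= t -> n t <= n s.
Proof.
move=> s0 st; apply: (le_trans (weight_decay wn s0 st)).
by rewrite ler_piMl ?weight_ge0// -expR0 ler_expR subr_le0.
Qed.

(** n is e^(-s) times the inverse of a monotone function.  The inverse is taken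
    as a power of exponent -1, whose measurability is known on the whole line. *)
Lemma measurable_weight : measurable_fun setT n.
Proof.
have -> : n = fun s => (expR s)^-1 * (expR s * n s)^-1 `^ (-1).
  apply/funext => s.
  rewrite powR_inv1 ?invr_ge0 ?mulr_ge0 ?expR_ge0 ?weight_ge0// invrK.
  by rewrite mulrA mulVf ?mul1r// gt_eqF ?expR_gt0.
have mE : measurable_fun [set: R] (fun s => (expR s)^-1).
  apply: nonincreasing_measurable => // s t st.
  by rewrite lef_pV2 ?posrE ?expR_gt0// ler_expR.
have mp : measurable_fun [set: R] (fun s => (expR s * n s)^-1).
  apply: nondecreasing_measurable => // s t st.
  have [s0|s0] := leP s 0.
    by rewrite (weight_le0 wn s0) mulr0 invr0 invr_ge0 mulr_ge0 ?expR_ge0 ?weight_ge0.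
  have t0 := lt_le_trans s0 st.
  rewrite lef_pV2 ?posrE ?mulr_gt0 ?expR_gt0 ?(weight_gt0 wn)//.
  have := weight_decay wn s0 st.
  rewrite -(ler_pM2l (expR_gt0 t)) mulrA -expRD.
  by have -> : t + (s - t) = s by ring.
apply: measurable_funM => //.
exact: (measurableT_comp (measurable_powR _)).
Qed.

Lemma measurable_weightV : measurable_fun setT (fun s => (n s)^-1).
Proof.
have -> : (fun s => (n s)^-1) = (fun s => n s `^ (-1)).
  by apply/funext => s; rewrite powR_inv1 ?weight_ge0.
exact: (measurableT_comp (measurable_powR _) measurable_weight).
Qed.

Lemma measurable_ratio k : measurable_fun setT k ->
  measurable_fun setT (fun x => k x / n x).
Proof. by move=> mk; apply: measurable_funM => //; exact: measurable_weightV. Qed.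

Lemma ratio_bound k s x : L1pos k -> x <= s -> `|k x / n x| <= (n s)^-1 * `|k x|.
Proof.
move=> [_ k0] xs; rewrite normrM mulrC.
have [x0|x0] := leP x 0; first by rewrite k0// normr0 !mulr0.
apply: ler_wpM2r => //; rewrite normfV ger0_norm ?weight_ge0//.
by rewrite lef_pV2 ?posrE ?(weight_gt0 wn) ?(lt_le_trans x0)// weight_nonincr.
Qed.

Lemma ratio_integrable k s : L1pos k ->
  mu.-integrable `]-oo, s] (EFin \o (fun x => k x / n x)).
Proof.
move=> kL; have mk := L1pos_measurable kL.
apply: (@le_integrable _ _ _ mu _ _ _ (EFin \o (fun x => (n s)^-1 * k x))) => //.
- by apply/measurable_EFinP; apply: measurable_funTS; exact: measurable_ratio.
- move=> x /=; rewrite in_itv/= => xs; rewrite lee_fin [leRHS]normrM.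
  by rewrite normfV (ger0_norm (weight_ge0 s)); exact: ratio_bound.
- by apply: (@integrableS _ _ _ mu setT) => //; exact: (L1posZ _ kL).1.
Qed.

(** Integrals of k / n over subsets of ]-oo, s], multiplied by n(s), are
    dominated by a kernel operator, which puts them in reach of the Schur test. *)
Lemma window_bound k s (I : set R) : L1pos k -> measurable I -> I `<=` `]-oo, s] ->
  (`|n s * \int[mu]_(x in I) (k x / n x)|%:E <=
   \int[mu]_x (\1_I x * (n s / n x) * `|k x|)%:E)%E.
Proof.
move=> kL mI Is.
have Ii : mu.-integrable I (EFin \o (fun x => k x / n x)).
  by apply: (@integrableS _ _ _ mu `]-oo, s]%classic) => //; exact: ratio_integrable.
have Ia : mu.-integrable I (EFin \o (fun x => `|k x / n x|)).
  exact: (integrable_abse Ii).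
rewrite normrM (ger0_norm (weight_ge0 s)).
apply: (@le_trans _ _ (n s * \int[mu]_(x in I) `|k x / n x|)%:E).
  by rewrite lee_fin ler_wpM2l ?weight_ge0// le_normr_Rintegral.
rewrite EFinM /Rintegral fineK; last exact: integrable_fin_num.
rewrite -ge0_integralZl//; last 2 first.
- by case/integrableP : Ia.
- by rewrite lee_fin weight_ge0.
rewrite integral_mkcond; apply: ge0_le_integral => //.
- by move=> x _; rewrite patchE; case: ifPn => // _; rewrite mule_ge0// lee_fin ?weight_ge0.
- apply/(measurable_restrictT _ mI)/measurable_funeM.
  by case/integrableP : Ia.
- have mk := L1pos_measurable kL.
  apply/measurable_EFinP; apply: measurable_funM; last exact: measurableT_comp.
  apply: measurable_funM; first exact: measurable_indic.
  by apply: measurable_funM => //; exact: measurable_weightV.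
- move=> x _; rewrite patchE indicE; case: ifPn => xI; last by rewrite !mul0r.
  rewrite -EFinM lee_fin mul1r normrM normfV (ger0_norm (weight_ge0 x)).
  by rewrite (mulrC `|k x|) mulrA.
Qed.

Lemma weighted_window (E : set (R * R)) (c : R) k : measurable E -> 0 <= c -> L1pos k ->
  (forall x : R, (0 < x)%R -> \int[mu]_s (\1_E (s, x) * (n s / n x))%:E <= c%:E)%E ->
  (\int[mu]_s \int[mu]_x (\1_E (s, x) * (n s / n x) * `|k x|)%:E <= c%:E * L1norm k)%E.
Proof.
move=> mE c0 kL Ec.
apply: (schur_test (K := fun z => \1_E z * (n z.1 / n z.2))) => //.
- apply: measurable_funM; first exact: measurable_indic.
  apply: measurable_funM; first exact: (measurableT_comp measurable_weight).
  exact: (measurableT_comp measurable_weightV).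
- by move=> z; rewrite !mulr_ge0 ?invr_ge0 ?weight_ge0.
- exact: L1pos_measurable.
- move=> x kx; apply: Ec; rewrite ltNge; apply/negP => x0.
  by move: kx; rewrite kL.2// eqxx.
Qed.

Lemma measurable_below : measurable [set z : R * R | z.2 <= z.1].
Proof.
have := @measurable_fun_ler _ (R * R)%type R setT snd fst measurable_snd measurable_fst.
move=> /(_ measurableT [set true] I); rewrite setTI.
by congr measurable; apply/seteqP; split => z //=.
Qed.

End WeightedTranslation.

(** * Norm bounds for the resolvent and for backward averages *)

Section Resolvent.
Context {R : realType}.
Local Notation mu := (@lebesgue_measure R).
Variables (lam : R) (n : R -> R).
Hypothesis wn : decaying_weight n.
Implicit Types k f : R -> R.
Local Notation trans := (weighted_shift lam n).
Local Notation prim := (ratio_prim n).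
Local Notation res := (shift_resolvent n).
Local Notation avg := (window_avg n).

Lemma prim_le0 k s : L1pos k -> s <= 0 -> prim k s = 0.
Proof.
move=> kL s0; rewrite /ratio_prim (@eq_Rintegral _ _ _ _ _ (fun=> 0)) ?Rintegral_cst ?mul0r//.
by move=> x; rewrite inE/= in_itv/= => xs; rewrite kL.2 ?mul0r// (le_trans xs).
Qed.

Lemma prim_window k s t : L1pos k -> t <= s ->
  prim k s - prim k t = \int[mu]_(x in `]t, s]) (k x / n x).
Proof.
move=> kL ts; apply: Rintegral_itvB; rewrite ?bnd_simp//.
exact: ratio_integrable.
Qed.

Lemma prim_lin k f a b s : L1pos k -> L1pos f ->
  prim (fun x => a * k x + b * f x) s = a * prim k s + b * prim f s.
Proof.
move=> kL fL; rewrite /ratio_prim -!RintegralZl ?ratio_integrable//.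
rewrite -RintegralD//; last 2 first.
- have := ratio_integrable wn s (L1posZ a kL).
  by apply: eq_integrable => // x _ /=; rewrite mulrA.
- have := ratio_integrable wn s (L1posZ b fL).
  by apply: eq_integrable => // x _ /=; rewrite mulrA.
by apply: eq_Rintegral => x _; ring.
Qed.

Lemma prim_nd k : L1pos k -> (forall x, 0 <= k x) -> {homo prim k : s t / s <= t}.
Proof.
move=> kL k0 s t st; rewrite -subr_ge0 prim_window//.
by apply: Rintegral_ge0 => x _; rewrite divr_ge0 ?(weight_ge0 wn).
Qed.

(** Monotone for nonnegative k, hence a difference of monotone functions in
    general. *)
Lemma measurable_prim k : L1pos k -> measurable_fun setT (prim k).
Proof.
move=> kL; have kpL := L1pos_funrpos kL; have knL := L1pos_funrneg kL.
have -> : prim k = fun s => prim k^\+ s - prim k^\- s.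
  apply/funext => s; have := prim_lin 1 (-1) s kpL knL.
  rewrite mul1r mulN1r => <-; congr ratio_prim.
  by apply/funext => x; rewrite mul1r mulN1r -funr_split.
apply: measurable_funB; apply: nondecreasing_measurable => //; apply: prim_nd => //.
Qed.

Lemma measurable_res k : L1pos k -> measurable_fun setT (res k).
Proof.
move=> kL; apply: measurable_funM; first exact: measurable_weight.
exact: measurable_prim.
Qed.

(** Common source of the bounds on [shift_resolvent] and [window_avg]: both are
    dominated by the kernel n(s) / n(x) restricted to a set E of pairs (s, x). *)
Lemma window_operator (E : set (R * R)) (D : set R) (c : R) k (g : R -> R) :
  measurable E -> measurable D -> 0 <= c -> L1pos k -> measurable_fun setT g ->
  (forall x : R, (0 < x)%R -> \int[mu]_s (\1_E (s, x) * (n s / n x))%:E <= c%:E)%E ->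
  (forall s, D s -> `|g s|%:E <= \int[mu]_x (\1_E (s, x) * (n s / n x) * `|k x|)%:E)%E ->
  (\int[mu]_(s in D) `|g s|%:E <= c%:E * L1norm k)%E.
Proof.
move=> mE mD c0 kL mg Ec gE; have mk := L1pos_measurable kL.
apply: le_trans (weighted_window wn mE c0 kL Ec).
rewrite integral_mkcond; apply: ge0_le_integral => //.
- by move=> s _; rewrite patchE; case: ifPn => // _; rewrite lee_fin.
- apply/(measurable_restrictT _ mD); apply: measurable_funTS.
  by apply/measurable_EFinP; exact: measurableT_comp.
- have mK : measurable_fun setT (fun z : R * R =>
      (\1_E z * (n z.1 / n z.2) * `|k z.2|)%:E).
    apply/measurable_EFinP; apply: measurable_funM.
      apply: measurable_funM; first exact: measurable_indic.
      apply: measurable_funM; first exact: (measurableT_comp (measurable_weight wn)).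
      exact: (measurableT_comp (measurable_weightV wn)).
    by apply: measurableT_comp => //; apply: (measurableT_comp mk).
  apply: (@measurable_fun_fubini_tonelli_F _ _ _ _ R mu _ mK) => z.
  by rewrite lee_fin !mulr_ge0 ?invr_ge0 ?(weight_ge0 wn).
- move=> s _; rewrite patchE; case: ifPn => Ds; first by apply: gE; rewrite inE in Ds.
  by apply: integral_ge0 => x _; rewrite lee_fin !mulr_ge0 ?invr_ge0 ?(weight_ge0 wn).
Qed.

Lemma measurable_section_ratio (E : set (R * R)) x : measurable E ->
  measurable_fun setT (fun s => (\1_E (s, x) * (n s / n x))%:E).
Proof.
move=> mE; apply/measurable_EFinP; apply: measurable_funM.
  apply: (measurableT_comp (measurable_indic mE)).
  exact: measurable_fun_pair.
by apply: measurable_funM => //; exact: measurable_weight.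
Qed.

(** With D the whole line this bounds the resolvent; with D = ]N, oo[ it bounds,
    uniformly in k, the mass that the resolvent sends beyond N. *)
Lemma res_tail (D : set R) (c : R) k : measurable D -> 0 <= c -> L1pos k ->
  (forall x : R, (0 < x)%R ->
    \int[mu]_(s in D `&` `[x, +oo[) (n s / n x)%:E <= c%:E)%E ->
  (\int[mu]_(s in D) `|res k s|%:E <= c%:E * L1norm k)%E.
Proof.
move=> mD c0 kL Dc.
pose E : set (R * R) := (D `*` setT) `&` [set z | z.2 <= z.1].
have mE : measurable E.
  by apply: measurableI; [exact: measurableX|exact: measurable_below].
apply: (window_operator mE) => //; first exact: measurable_res.
- move=> x x0; apply: le_trans (Dc x x0); rewrite [leRHS]integral_mkcond le_eqVlt.
  apply/orP; left; apply/eqP; apply: eq_integral => s _; rewrite patchE indicE.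
  suff -> : ((s, x) \in E) = (s \in D `&` `[x, +oo[) by case: ifPn => _; rewrite ?mul1r ?mul0r.
  by apply/idP/idP; rewrite !inE /E/= in_itv/= andbT; tauto.
- move=> s Ds.
  apply: le_trans (window_bound wn kL _ (@subset_refl _ `]-oo, s]%classic)) _ => //.
  rewrite le_eqVlt; apply/orP; left; apply/eqP; apply: eq_integral => x _.
  rewrite !indicE; suff -> : ((s, x) \in E) = (x \in `]-oo, s]%classic) by [].
  by apply/idP/idP; rewrite !inE /E/= in_itv/=; tauto.
Qed.

Lemma res_norm k : L1pos k -> (L1norm (res k) <= L1norm k)%E.
Proof.
move=> kL; rewrite -[leRHS]mul1e.
apply: res_tail => // x x0; rewrite setTI.
apply: (@le_trans _ _ (\int[mu]_(s in `[x, +oo[) (expR (- (1 * (s - x))))%:E)%E); last first.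
  by rewrite integral_exp_tail// invr1.
apply: ge0_le_integral => //.
- by move=> s _; rewrite lee_fin divr_ge0 ?(weight_ge0 wn).
- apply/measurable_EFinP; apply: measurable_funTS.
  by apply: measurable_funM => //; exact: measurable_weight.
- apply/measurable_EFinP; apply: measurable_funTS.
  apply: measurableT_comp => //; apply: measurableT_comp => //.
  by apply: measurable_funM => //; exact: measurable_funB.
- move=> s; rewrite /= in_itv/= andbT => xs; rewrite lee_fin ler_pdivrMr ?(weight_gt0 wn)//.
  by rewrite mul1r opprB; exact: weight_decay.
Qed.

Lemma L1pos_res k : L1pos k -> L1pos (res k).
Proof.
move=> kL; apply: L1posI; first exact: measurable_res.
  by move=> x x0; rewrite /shift_resolvent (weight_le0 wn x0) mul0r.
by apply: le_lt_trans (res_norm kL) _; exact: L1norm_lty.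
Qed.

Lemma measurable_avg t k : L1pos k -> measurable_fun setT (avg t k).
Proof.
move=> kL; apply: measurable_funM => //; apply: measurable_funM.
  exact: measurable_weight.
apply: measurable_funB; first exact: measurable_prim.
by apply: (measurableT_comp (measurable_prim kL)); exact: measurable_funB.
Qed.

(** Each x contributes to the averages at s in [x, x + t[ only, a window of
    length t on which n(s) <= n(x). *)
Lemma avg_norm t k : 0 < t -> L1pos k -> (L1norm (avg t k) <= L1norm k)%E.
Proof.
move=> t0 kL.
pose g s := n s * (prim k s - prim k (s - t)).
have mg : measurable_fun setT g.
  have -> : g = fun s => t * avg t k s.
    by apply/funext => s; rewrite /window_avg mulrA divff ?mul1r// gt_eqF.
  by apply: measurable_funM => //; exact: measurable_avg.
suff gk : (L1norm g <= t%:E * L1norm k)%E.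
  have -> : L1norm (avg t k) = (t^-1%:E * L1norm g)%E.
    by rewrite -[t^-1 in RHS]ger0_norm ?invr_ge0 ?ltW// -L1normZ.
  by rewrite lee_pdivrMl.
pose E : set (R * R) := [set z | z.2 <= z.1] `&` ~` [set z | z.2 <= z.1 - t].
have mE : measurable E.
  apply: measurableI; first exact: measurable_below.
  apply: measurableC.
  have mf : measurable_fun setT (fun z : R * R => (z.1 - t, z.2)).
    by apply: measurable_fun_pair => //; exact: measurable_funB.
  by have := mf measurableT _ measurable_below; rewrite setTI.
have EE s x : ((s, x) \in E) = (x \in `]s - t, s]%classic).
  apply/idP/idP; rewrite !inE /E/= in_itv/= ltNge; first by move=> [-> /negP ->].
  by move=> /andP[/negP ? ->].
apply: (window_operator mE) => //; first exact: ltW.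
- move=> x x0.
  have le1 : (\int[mu]_s (\1_E (s, x) * (n s / n x))%:E <=
             \int[mu]_(s in `[x, (x + t)%R[) 1%:E)%E; last first.
    apply: (le_trans le1); rewrite integral_cst//= mul1e lebesgue_measure_itv/= lte_fin.
    by rewrite ltrDl t0 -EFinB lee_fin addrC addKr.
  rewrite [leRHS]integral_mkcond; apply: ge0_le_integral => //.
  + by move=> s _; rewrite lee_fin !mulr_ge0 ?invr_ge0 ?(weight_ge0 wn).
  + exact: measurable_section_ratio.
  + by apply/(measurable_restrictT _ (measurable_itv _)); exact: measurable_cst.
  + move=> s _; rewrite indicE EE patchE.
    have -> : (s \in `[x, (x + t)[%classic) = (x \in `]s - t, s]%classic).
      by rewrite !mem_setE !in_itv/= ltrBlDr andbC.
    case: ifPn; last by rewrite mul0r.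
    rewrite inE/= in_itv/= mul1r => /andP[_ xs].
    by rewrite lee_fin ler_pdivrMr ?(weight_gt0 wn)// mul1r; exact: weight_nonincr.
- move=> s _; rewrite /g prim_window ?gerBl ?(ltW t0)//.
  have sub : `]s - t, s]%classic `<=` `]-oo, s]%classic.
    by move=> x /=; rewrite !in_itv/= => /andP[].
  apply: (le_trans (window_bound wn kL (measurable_itv _) sub)).
  rewrite le_eqVlt; apply/orP; left; apply/eqP; apply: eq_integral => x _.
  by rewrite !indicE EE.
Qed.


End Resolvent.

(** * The generator of a weighted translation semigroup *)

Section Generator.
Context {R : realType}.
Local Notation mu := (@lebesgue_measure R).
Variables (lam : R) (n : R -> R).
Hypothesis wn : decaying_weight n.
Implicit Types (k f : R -> R) (u : nat -> R).
Local Notation trans := (weighted_shift lam n).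
Local Notation prim := (ratio_prim n).
Local Notation res := (shift_resolvent n).
Local Notation avg := (window_avg n).

Lemma ratio_locally_integrable k : L1pos k ->
  locally_integrable setT (fun x => k x / n x).
Proof.
move=> kL; split; [|exact: openT|].
  by apply: measurable_ratio => //; exact: L1pos_measurable.
move=> K _ cK.
have [M [Mreal KM]] := compact_bounded cK.
have KM1 : K `<=` `]-oo, M + 1]%classic.
  move=> x Kx; rewrite /= in_itv/=; apply: (le_trans (ler_norm x)).
  by apply: KM => //; rewrite ltrDl.
have : mu.-integrable K (EFin \o (fun x => k x / n x)).
  apply: (@integrableS _ _ _ mu `]-oo, M + 1]%classic) => //.
  - exact: compact_measurable.
  - exact: ratio_integrable.
by case/integrableP.
Qed.

(** At a Lebesgue point x, the primitive of k / n has derivative k(x) / n(x). *)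
Lemma avg_ae_cvg k u : L1pos k -> (forall m, 0 < u m) -> u m @[m --> \oo] --> 0 ->
  {ae mu, forall x, avg (u m) k x @[m --> \oo] --> k x}.
Proof.
move=> kL u0 ucvg.
have := FTC1Ny (fun y => ratio_integrable wn y kL) (ratio_locally_integrable kL).
apply: filterS; first exact: (ae_filter_ringOfSetsType mu).
move=> x [dF F'].
have [x0|x0] := leP x 0.
  rewrite kL.2//; apply: cvg_near_cst; apply: nearW => m.
  by rewrite /window_avg (weight_le0 wn x0) mul0r mulr0.
have -> : k x = n x * (k x / n x) by rewrite mulrC divfK// gt_eqF// (weight_gt0 wn).
have -> : (fun m => avg (u m) k x) =
    (fun m => n x * ((- u m)^-1 * (prim k (- u m *: 1 + x) - prim k x))).
  apply/funext => m; by rewrite /window_avg [- u m *: 1]mulr1 [in RHS]invrN [- u m + x]addrC; ring.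
apply: cvgMr => /=; rewrite -F'.
have : (fun h => h^-1 *: (prim k (h *: 1 + x) - prim k x)) @ 0^' --> (prim k)^`()%classic x.
  by rewrite derive1E; exact: dF.
move=> /cvgr_dnbhsP; apply.
split; first by move=> m; rewrite oppr_eq0 gt_eqF.
by rewrite -oppr0; exact: cvgN.
Qed.

Lemma avg_lin t k f a b s : L1pos k -> L1pos f ->
  avg t (fun x => a * k x + b * f x) s = a * avg t k s + b * avg t f s.
Proof. by move=> kL fL; rewrite /window_avg !(prim_lin wn)//; ring. Qed.

Lemma avg_cvg_ge0 k u : L1pos k -> (forall x, 0 <= k x) ->
  (forall m, 0 < u m) -> u m @[m --> \oo] --> 0 ->
  L1norm (fun x => avg (u m) k x - k x) @[m --> \oo] --> 0%E.
Proof.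
move=> kL k0 u0 ucvg; apply: scheffe => //.
- by move=> m; exact: (measurable_avg wn _ kL).
- move=> m x; rewrite /window_avg mulr_ge0 ?invr_ge0 ?(ltW (u0 m))// mulr_ge0 ?(weight_ge0 wn)//.
  by rewrite subr_ge0; apply: (prim_nd wn) => //; rewrite gerBl ltW.
- exact: kL.1.
- exact: avg_ae_cvg.
- by move=> m; exact: (avg_norm wn (u0 m) kL).
Qed.

Lemma avg_cvg k u : L1pos k -> (forall m, 0 < u m) -> u m @[m --> \oo] --> 0 ->
  L1norm (fun x => avg (u m) k x - k x) @[m --> \oo] --> 0%E.
Proof.
move=> kL u0 ucvg; have kpL := L1pos_funrpos kL; have knL := L1pos_funrneg kL.
have mB m f : L1pos f -> measurable_fun setT (fun x => avg (u m) f x - f x).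
  move=> fL; apply: measurable_funB; first exact: (measurable_avg wn _ fL).
  exact: L1pos_measurable.
apply: (@squeeze_cvge _ _ _ _ (cst 0%E) _
  (fun m => L1norm (fun x => avg (u m) k^\+ x - k^\+ x)%R +
            L1norm (fun x => avg (u m) k^\- x - k^\- x)%R)%E).
- apply: nearW => m; rewrite L1norm_ge0/=.
  apply: le_trans (L1norm_triangleB (mB m _ kpL) (mB m _ knL)).
  rewrite le_eqVlt; apply/orP; left; apply/eqP; apply: eq_L1norm => x.
  have -> : avg (u m) k x = avg (u m) k^\+ x - avg (u m) k^\- x.
    have := avg_lin (u m) 1 (-1) x kpL knL; rewrite mul1r mulN1r => <-.
    by congr window_avg; apply/funext => y; rewrite mul1r mulN1r -funr_split.
  by rewrite [k x in LHS]funr_split; ring.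
- exact: cvg_cst.
- rewrite -(adde0 0%E); apply: cvgeD => //; apply: avg_cvg_ge0 => // x.
Qed.

Lemma trans_res t k s : L1pos k -> 0 < t ->
  trans t (res k) s = expR (lam * t) * (n s * prim k (s - t)).
Proof.
move=> kL t0; rewrite /weighted_shift /shift_resolvent -!mulrA; congr *%R; congr *%R.
have [st|st] := leP (s - t) 0; first by rewrite (prim_le0 _ kL st) !mulr0.
by rewrite mulKf// gt_eqF// (weight_gt0 wn).
Qed.

(** Together with [trans_res]: the resolvent commutes with the semigroup. *)
Lemma res_trans t k s : L1pos k -> 0 < t ->
  res (trans t k) s = expR (lam * t) * (n s * prim k (s - t)).
Proof.
move=> kL t0; rewrite /shift_resolvent mulrCA; congr *%R.
pose I := `]-oo, s - t]%classic.
pose q := (fun x => k x / n x) \_ I.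
have qi : mu.-integrable setT (EFin \o q).
  have := ratio_integrable wn (s - t) kL.
  by rewrite integrable_mkcond// restrict_EFin.
transitivity (\int[mu]_x (expR (lam * t) * q (x - t))).
  rewrite /ratio_prim Rintegral_mkcond; apply: eq_Rintegral => x _.
  rewrite /q !patchE !mem_setE !in_itv/= lerD2r; case: ifPn => [xs|_]; last by rewrite mulr0.
  rewrite /weighted_shift -!mulrA; congr *%R.
  have [x0|x0] := leP x 0.
    by rewrite (kL.2 (x - t)) ?mul0r ?mulr0// subr_le0 (le_trans x0)// ltW.
  by rewrite -[RHS]mul1r -(mulfV (_ : n x != 0)) ?gt_eqF ?(weight_gt0 wn)//; ring.
rewrite RintegralZl//; last exact: integrable_translate.
by congr *%R; rewrite Rintegral_translate// /ratio_prim [RHS]Rintegral_mkcond.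
Qed.

Lemma L1pos_trans t k : L1pos k -> 0 < t -> L1pos (trans t k).
Proof.
move=> kL t0; have mk := L1pos_measurable kL.
have mt : measurable_fun [set: R] (fun x : R => x - t) by exact: measurable_funB.
have mT : measurable_fun setT (trans t k).
  apply: measurable_funM; last exact: (measurableT_comp mk).
  apply: measurable_funM => //; apply: measurable_funM; first exact: measurable_weight.
  exact: (measurableT_comp (measurable_weightV wn)).
have k0 x : x <= 0 -> k (x - t) = 0.
  by move=> x0; rewrite kL.2// subr_le0 (le_trans x0)// ltW.
apply: L1posI => //; first by move=> x x0; rewrite /weighted_shift k0// mulr0.
have kti := integrable_translate t kL.1.
have : L1pos (fun x => expR (lam * t) * k (x - t)).
  by apply: L1posZ; split.
move=> /L1norm_lty; apply: le_lt_trans; apply: ge0_le_integral => //.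
- by apply/measurable_EFinP; exact: measurableT_comp.
- apply/measurable_EFinP; apply: measurableT_comp => //; apply: measurable_funM => //.
  exact: (measurableT_comp mk).
- move=> x _; rewrite lee_fin /weighted_shift !normrM; apply: ler_wpM2r => //.
  apply: ler_piMr => //; rewrite normfV !ger0_norm ?(weight_ge0 wn)//.
  have [xt|xt] := leP (x - t) 0; first by rewrite (weight_le0 wn xt) invr0 mulr0.
  rewrite ler_pdivrMr ?(weight_gt0 wn)// mul1r (weight_nonincr wn)//.
  by rewrite gerBl ltW.
Qed.

Lemma expR_slope_cvg u : (forall m, 0 < u m) -> u m @[m --> \oo] --> 0 ->
  (u m)^-1 * (expR (lam * u m) - 1) @[m --> \oo] --> lam.
Proof.
move=> u0 ucvg.
pose h (t : R) := expR (lam *: t).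
have [dh Dh] : is_derive (0 : R) 1 h lam.
  have d1 : is_derive (0 : R) 1 (lam \*: (@id R)) (lam *: 1) by exact: is_deriveZ.
  have := is_derive1_comp (is_derive_expR ((lam \*: (@id R)) 0)) d1.
  by rewrite /= scaler0 expR0 mul1r [lam *: 1]mulr1.
have : (fun x => x^-1 *: ((h \o shift 0) (x *: 1) - h 0)) @ 0^' --> 'D_1 h 0 by exact: dh.
rewrite Dh => /cvgr_dnbhsP/(_ u); rewrite /h.
rewrite /= scaler0 expR0 => H.
have -> : (fun m => (u m)^-1 * (expR (lam * u m) - 1)) =
    (fun m => (u m)^-1 *: (expR (lam *: (u m *: 1 + 0)) - 1)).
  by apply/funext => m; rewrite addr0 [u m *: 1]mulr1.
by apply: H; split => // m; rewrite gt_eqF.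
Qed.

(** With Q the primitive of k / n one has n(s) Q(s - t) = V k (s) - t A_t k (s),
    A_t k being the backward average.  The quotient minus lam V k - k is
    then a combination of V k and A_t k with coefficients tending to 0, minus
    A_t k - k. *)
Lemma gen_res k u : L1pos k -> (forall m, 0 < u m) -> u m @[m --> \oo] --> 0 ->
  L1norm (fun x => (u m)^-1 * (trans (u m) (res k) x - res k x)
                   - (lam * res k x - k x)) @[m --> \oo] --> 0%E.
Proof.
move=> kL u0 ucvg; have rL := L1pos_res wn kL.
pose c1 m := (u m)^-1 * (expR (lam * u m) - 1) - lam.
pose c2 m := expR (lam * u m) - 1.
have c1cvg : c1 m @[m --> \oo] --> 0.
  rewrite -(subrr lam); apply: cvgB; last exact: cvg_cst.
  exact: expR_slope_cvg.
have c2cvg : c2 m @[m --> \oo] --> 0.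
  have -> : c2 = fun m => u m * ((u m)^-1 * (expR (lam * u m) - 1)).
    by apply/funext => m; rewrite mulrA divff ?mul1r// gt_eqF.
  by rewrite -(mul0r lam); apply: cvgM => //; exact: expR_slope_cvg.
have mA m := measurable_avg wn (u m) kL.
have mk := L1pos_measurable kL; have mr := L1pos_measurable rL.
apply: (@squeeze_cvge _ _ _ _ (cst 0%E) _
  (fun m => `|c1 m|%:E * L1norm (res k) + `|c2 m|%:E * L1norm k +
            L1norm (fun x => avg (u m) k x - k x)%R)%E).
- apply: nearW => m; rewrite L1norm_ge0/=.
  have -> : L1norm (fun x => (u m)^-1 * (trans (u m) (res k) x - res k x)
                   - (lam * res k x - k x)) =
    L1norm (fun x => (c1 m * res k x - c2 m * avg (u m) k x) - (avg (u m) k x - k x)).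
    apply: eq_L1norm => x; rewrite trans_res// /c1 /c2 /shift_resolvent /window_avg.
    have un0 : u m != 0 by rewrite gt_eqF.
    by field.
  apply: le_trans (L1norm_triangleB _ _) _.
  + by apply: measurable_funB; exact: measurable_funM.
  + exact: measurable_funB.
  apply: leeD => //; apply: le_trans (L1norm_triangleB _ _) _.
  + exact: measurable_funM.
  + exact: measurable_funM.
  rewrite (L1normZ (c1 m))// (L1normZ (c2 m))//; apply: leeD => //; apply: lee_wpmul2l;
    first by rewrite lee_fin.
  exact: (avg_norm wn (u0 m) kL).
- exact: cvg_cst.
- have cz (c : nat -> R) f : L1pos f -> c m @[m --> \oo] --> 0 ->
      (`|c m|%:E * L1norm f)%E @[m --> \oo] --> 0%E.
    move=> fL ccvg; rewrite -(mul0e (L1norm f)); apply: cvgeZr; first exact: L1pos_fin.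
    apply: cvg_EFin; first exact: nearW.
    by rewrite -(normr0 R); apply: cvg_norm.
  rewrite -(adde0 0%E); apply: cvgeD => //; last exact: avg_cvg.
  by rewrite -(adde0 0%E); apply: cvgeD => //; exact: cz.
Qed.

Lemma res_lin k f a b s : L1pos k -> L1pos f ->
  res (fun x => a * k x + b * f x) s = a * res k s + b * res f s.
Proof. by move=> kL fL; rewrite /shift_resolvent (prim_lin wn)//; ring. Qed.

(** Apply the resolvent V to the quotients of k: since V commutes with the
    semigroup, these are the quotients of V k, whose limit is lam V k - k by
    [gen_res], and also lam V k - V f by continuity of V. *)
Lemma gen_unique k f u : L1pos k -> L1pos f ->
  (forall m, 0 < u m) -> u m @[m --> \oo] --> 0 ->
  L1norm (fun x => (u m)^-1 * (trans (u m) k x - k x) - (lam * k x - f x))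
    @[m --> \oo] --> 0%E ->
  L1norm (fun x => k x - res f x) = 0%E.
Proof.
move=> kL fL u0 ucvg Dcvg.
have gcvg := gen_res kL u0 ucvg.
pose D m x := (u m)^-1 * (trans (u m) k x - k x) - (lam * k x - f x).
pose G m x := (u m)^-1 * (trans (u m) (res k) x - res k x) - (lam * res k x - k x).
have tL m := L1pos_trans kL (u0 m).
have DL m : L1pos (D m).
  by apply: L1posB; [apply: L1posZ; exact: L1posB|apply: L1posB => //; exact: L1posZ].
have rkL := L1pos_res wn kL; have rfL := L1pos_res wn fL.
have GL m : L1pos (G m).
  apply: L1posB; [apply: L1posZ; apply: L1posB => //|apply: L1posB => //; exact: L1posZ].
  exact: L1pos_trans.
have resD m x : res (D m) x =
    (u m)^-1 * (trans (u m) (res k) x - res k x) - (lam * res k x - res f x).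
  have -> : D m = fun x => 1 * ((u m)^-1 * trans (u m) k x + (- (u m)^-1 - lam) * k x) + 1 * f x.
    by apply/funext => y; rewrite /D; ring.
  rewrite res_lin//; last first.
    by apply: L1posD; exact: L1posZ.
  by rewrite res_lin// res_trans// trans_res//; ring.
(* For every m, k - V f = G m - V (D m), and both terms tend to 0. *)
have le0 m : (L1norm (fun x => k x - res f x)%R <= L1norm (G m) + L1norm (D m))%E.
  have -> : L1norm (fun x => k x - res f x) = L1norm (fun x => G m x - res (D m) x).
    by apply: eq_L1norm => x; rewrite resD /G; ring.
  apply: le_trans (L1norm_triangleB _ _) _.
  - exact: L1pos_measurable (GL m).
  - exact: L1pos_measurable (L1pos_res wn (DL m)).
  by apply: leeD => //; exact: res_norm.
apply/eqP; rewrite eq_le L1norm_ge0 andbT.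
have c : (L1norm (G m) + L1norm (D m))%E @[m --> \oo] --> 0%E.
  by rewrite -(adde0 0%E); apply: cvgeD.
by apply: (cvge_to_ge c); apply: nearW.
Qed.

End Generator.

(** * Compactness of the resolvent of a weighted translation *)

Section Compactness.
Context {R : realType}.
Local Notation mu := (@lebesgue_measure R).
Variables (n : R -> R).
Hypothesis wn : decaying_weight n.
Implicit Types (k f : R -> R) (u : nat -> R).
Local Notation prim := (ratio_prim n).
Local Notation res := (shift_resolvent n).

Lemma cvge0_near (a : nat -> \bar R) : (forall m, 0 <= a m)%E ->
  (forall e, 0 < e -> \forall m \near \oo, (a m <= e%:E)%E) -> a m @[m --> \oo] --> 0%E.
Proof.
move=> a0 ae; apply/fine_cvgP; split.
  apply: filterS (ae _ ltr01) => m am.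
  by rewrite ge0_fin_numE// (le_lt_trans am) ?ltry.
apply/cvgrPdist_le => e e0; apply: filterS (ae _ e0) => m am.
rewrite sub0r normrN /= ger0_norm ?fine_ge0//.
by rewrite -lee_fin fineK// ge0_fin_numE// (le_lt_trans am) ?ltry.
Qed.

(** Fatou's lemma for an almost everywhere convergent sequence. *)
Lemma fatou_norm (D : set R) (F : nat -> R -> R) f (C : \bar R) : measurable D ->
  (forall m, measurable_fun setT (F m)) -> measurable_fun setT f ->
  {ae mu, forall x, F m x @[m --> \oo] --> f x} ->
  (forall m, \int[mu]_(x in D) `|F m x|%:E <= C)%E ->
  (\int[mu]_(x in D) `|f x|%:E <= C)%E.
Proof.
move=> mD mF mf Ff FC.
have mFD m : measurable_fun D (fun x => (`|F m x|)%:E).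
  by apply/measurable_EFinP; apply: measurable_funTS; exact: measurableT_comp.
apply: (@le_trans _ _ (limn_einf (fun m => \int[mu]_(x in D) `|F m x|%:E))%E); last first.
  rewrite limn_einf_lim; apply: lime_le; first exact: is_cvg_einfs.
  apply: nearW => m; apply: le_trans (FC m).
  by apply: ereal_inf_lbound; exists m => /=.
apply: le_trans (fatou mu mD mFD _); last by move=> m x _; rewrite lee_fin.
apply: ae_ge0_le_integral => //.
- by apply/measurable_EFinP; apply: measurable_funTS; exact: measurableT_comp.
- move=> x _; rewrite limn_einf_lim; apply: lime_ge; first exact: is_cvg_einfs.
  by apply: nearW => m; apply: le_ereal_inf_tmp => _ [j _ <-]; rewrite lee_fin.
- rewrite /limn_einf; apply: measurableT_comp => //.
  by apply: measurable_fun_limn_esup => m; apply: measurableT_comp => //; exact: mFD.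
- move: Ff; apply: filterS; first exact: (ae_filter_ringOfSetsType mu).
  move=> x Fx _.
  have c : (`|F m x|%:E)%E @[m --> \oo] --> (`|f x|%:E)%E.
    by apply: cvg_EFin; [exact: nearW|exact: cvg_norm].
  by rewrite is_cvg_limn_einfE ?(cvg_lim _ c)//; apply/cvg_ex; eexists; exact: c.
Qed.

(** n(s) / n(x) <= 1 for 0 < x <= s. *)
Lemma res_sup k s : L1pos k -> (`|res k s|%:E <= L1norm k)%E.
Proof.
move=> kL; have mk := L1pos_measurable kL.
apply: (le_trans (window_bound wn kL (measurable_itv _) (@subset_refl _ `]-oo, s]%classic))).
apply: ge0_le_integral => //.
- by move=> x _; rewrite lee_fin !mulr_ge0 ?invr_ge0 ?(weight_ge0 wn).
- apply/measurable_EFinP; apply: measurable_funM; last exact: measurableT_comp.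
  apply: measurable_funM; first by apply: measurable_indic; exact: measurable_itv.
  by apply: measurable_funM => //; exact: (measurable_weightV wn).
- by apply/measurable_EFinP; exact: measurableT_comp.
- move=> x _; rewrite lee_fin ler_piMl// indicE.
  have [|_] := boolP (x \in _); last by rewrite mul0r.
  rewrite inE/= in_itv/= mul1r => xs.
  have [x0|x0] := leP x 0; first by rewrite (weight_le0 wn x0) invr0 mulr0.
  by rewrite ler_pdivrMr ?(weight_gt0 wn)// mul1r (weight_nonincr wn).
Qed.

Hypothesis tail : forall e, 0 < e -> exists N, forall x : R, 0 < x ->
  (\int[mu]_(s in `]N, +oo[ `&` `[x, +oo[) (n s / n x)%:E <= e%:E)%E.

(** The primitives of k / n are nondecreasing and bounded by M / n, so Helly's
    theorem applies to them.  The resolvents are bounded by M, which dominates them on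
    ]0, N], and the hypothesis [tail] makes the contribution of ]N, oo[ small
    along the sequence, hence also for the limit by Fatou's lemma. *)
Lemma res_compact_ge0 (k : nat -> R -> R) (M : R) :
  (forall m, L1pos (k m)) -> (forall m x, 0 <= k m x) ->
  (forall m, L1norm (k m) <= M%:E)%E ->
  exists (phi : nat -> nat) (v : R -> R),
    [/\ {homo phi : i j / (i < j)%N}, L1pos v &
        L1norm (fun x => res (k (phi m)) x - v x) @[m --> \oo] --> 0%E].
Proof.
move=> kL k0 kM.
have M0 : 0 <= M by rewrite -lee_fin (le_trans _ (kM 0%N))// L1norm_ge0.
have resM m s : `|res (k m) s| <= M by rewrite -lee_fin (le_trans (res_sup s (kL m)))//.
have primB m s : `|prim (k m) s| <= M / n s.
  have [s0|s0] := leP s 0; first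
    by rewrite (prim_le0 _ (kL m) s0) normr0 (weight_le0 wn s0) invr0 mulr0.
  rewrite ler_pdivlMr ?(weight_gt0 wn)// mulrC -[n s in leLHS](ger0_norm (weight_ge0 wn s)).
  by rewrite -normrM; exact: resM.
have [phi [L [phiS Lnd LB Lcvg]]] :=
  helly_selection (fun m => prim_nd wn (kL m) (k0 m)) primB.
pose v s := n s * L s.
pose F m s := res (k (phi m)) s.
have mF m : measurable_fun setT (F m) := measurable_res wn (kL (phi m)).
have mv : measurable_fun setT v.
  by apply: measurable_funM; [exact: (measurable_weight wn)|exact: nondecreasing_measurable].
have Fv : {ae mu, forall x, F m x @[m --> \oo] --> v x}.
  move: Lcvg; apply: filterS; first exact: (ae_filter_ringOfSetsType mu).
  by move=> x Lx; apply: cvgMr.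
have v0 s : s <= 0 -> v s = 0 by move=> s0; rewrite /v (weight_le0 wn s0) mul0r.
have F0 m s : s <= 0 -> F m s = 0.
  by move=> s0; rewrite /F /shift_resolvent (weight_le0 wn s0) mul0r.
have tailF e N : 0 < e -> (forall x : R, 0 < x ->
    (\int[mu]_(s in `]N, +oo[ `&` `[x, +oo[) (n s / n x)%:E <= e%:E)%E) ->
    forall m, (\int[mu]_(s in `]N, +oo[) `|F m s|%:E <= (e * M)%:E)%E.
  move=> e0 Ne m; have := res_tail wn (measurable_itv `]N, +oo[) (ltW e0) (kL (phi m)) Ne.
  move=> /le_trans; apply; rewrite EFinM; apply: lee_wpmul2l => //.
  by rewrite lee_fin ltW.
have vM : (L1norm v <= M%:E)%E.
  apply: (fatou_norm _ mF) => // m.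
  exact: le_trans (res_norm wn (kL _)) (kM _).
have vL : L1pos v by apply: L1posI => //; rewrite (le_lt_trans vM) ?ltry.
exists phi, v; split => //.
apply: cvge0_near => [m|e e0]; first exact: L1norm_ge0.
(* The total mass is at most M; M + 1 avoids a division by 0 when M = 0. *)
pose e' := e / 3 / (M + 1).
have M1 : 0 < M + 1 by rewrite ltr_wpDl.
have e'0 : 0 < e' by rewrite !divr_gt0.
have e'M : e' * M <= e / 3.
  rewrite /e' -mulrA ler_piMr ?divr_ge0 ?(ltW e0)//.
  by rewrite mulrC ler_pdivrMr// mul1r lerDl.
have [N Ne] := tail e'0.
pose D := `]-oo, N]%classic.
have mFv m : measurable_fun setT (fun x => (`|F m x - v x|)%:E).
  by apply/measurable_EFinP; apply: measurableT_comp => //; exact: measurable_funB.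
have split_norm m : L1norm (fun x => F m x - v x) =
    (\int[mu]_(x in D) `|F m x - v x|%:E + \int[mu]_(x in `]N, +oo[) `|F m x - v x|%:E)%E.
  have DU : D `|` `]N, +oo[%classic = setT.
    apply/seteqP; split => // x _; rewrite /D /= !in_itv/= andbT.
    by have [|] := leP x N; [left|right].
  rewrite -ge0_integral_setU//= ?DU//.
  - exact: measurable_itv.
  - exact: mFv.
  - by apply/disj_setPS => x []; rewrite /D/= !in_itv/= andbT leNgt => /negP.
have tail2 m : (\int[mu]_(x in `]N, +oo[) `|F m x - v x|%:E <= (e / 3 + e / 3)%:E)%E.
  have mT (f : R -> R) : measurable_fun setT f ->
      measurable_fun `]N, +oo[ (fun x => `|f x|%:E).
    by move=> mf; apply/measurable_EFinP/measurable_funTS; exact: measurableT_comp.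
  apply: (@le_trans _ _ (\int[mu]_(x in `]N, +oo[) (`|F m x|%:E + `|v x|%:E))%E).
    apply: ge0_le_integral => //.
    - by apply: measurable_funTS; exact: mFv.
    - by apply: emeasurable_funD; apply: mT.
    - by move=> x _; rewrite -EFinD lee_fin ler_normB.
  rewrite ge0_integralD//; [|exact: mT|exact: mT].
  rewrite EFinD; apply: leeD.
    by apply: (le_trans (tailF _ _ e'0 Ne m)); rewrite lee_fin.
  apply: (@le_trans _ _ (e' * M)%:E); last by rewrite lee_fin.
  exact: (fatou_norm _ mF mv Fv (tailF _ _ e'0 Ne)).
have [_ + _] : [/\ mu.-integrable D (EFin \o v),
   [sequence \int[mu]_(x in D) (`|(F m x)%:E - (v x)%:E|)]_m%E @ \oo --> 0%E &
   [sequence \int[mu]_(x in D) (F m x)%:E]_m%E @ \oo --> (\int[mu]_(x in D) (v x)%:E)%E].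
  apply: (@dominated_convergence _ _ _ mu _ (measurable_itv _) _ _
    (EFin \o (fun x => M * \1_(`]0, N]%classic) x))) => //.
  - by move=> m; apply/measurable_EFinP; apply: measurable_funTS; exact: mF.
  - by apply/measurable_EFinP; exact: measurable_funTS.
  - move: Fv; apply: filterS; first exact: (ae_filter_ringOfSetsType mu).
    by move=> x Fx _; apply: cvg_EFin; first exact: nearW.
  - apply: (@integrableS _ _ _ mu setT) => //.
    by apply: (integrableZl measurableT M (integrable_indic_itv 0 N _ _)).
  - apply: aeW => x m /=; rewrite /D/= in_itv/= lee_fin => xN.
    have [x0|x0] := leP x 0; first by rewrite F0// normr0 mulr_ge0.
    by rewrite indicE mem_set ?mulr1 ?resM//= in_itv/= x0.
have e3 : 0 < e / 3 by rewrite divr_gt0.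
move=> /fine_cvgP[+ /cvgrPdist_lt/(_ _ e3)].
move=> Hfin Hlt; near=> m.
rewrite split_norm (_ : e = e / 3 + (e / 3 + e / 3)); last by field.
rewrite EFinD; apply: leeD => //.
have : (\int[mu]_(x in D) `|F m x - v x|%:E)%E \is a fin_num by near: m.
have : `|0 - fine (\int[mu]_(x in D) `|F m x - v x|%:E)%E| < e / 3 by near: m.
rewrite sub0r normrN => h1 /fineK <-; rewrite lee_fin ltW//.
exact: le_lt_trans (ler_norm _) h1.
Unshelve. all: by end_near. Qed.

Lemma res_compact (k : nat -> R -> R) (M : R) :
  (forall m, L1pos (k m)) -> (forall m, L1norm (k m) <= M%:E)%E ->
  exists (phi : nat -> nat) (v : R -> R),
    [/\ {homo phi : i j / (i < j)%N}, L1pos v &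
        L1norm (fun x => res (k (phi m)) x - v x) @[m --> \oo] --> 0%E].
Proof.
move=> kL kM.
have kpM m : (L1norm ((k m)^\+)%R <= M%:E)%E.
  exact: le_trans (L1norm_funrpos (L1pos_measurable (kL m))) (kM m).
have knM m : (L1norm ((k m)^\-)%R <= M%:E)%E.
  exact: le_trans (L1norm_funrneg (L1pos_measurable (kL m))) (kM m).
have [phi [v [phiS vL vcvg]]] := res_compact_ge0 (fun m => L1pos_funrpos (kL m))
  (fun m => funrpos_ge0 (k m)) kpM.
have [psi [w [psiS wL wcvg]]] := res_compact_ge0 (fun m => L1pos_funrneg (kL (phi m)))
  (fun m => funrneg_ge0 (k (phi m))) (fun m => knM (phi m)).
exists (phi \o psi), (fun x => v x - w x); split.
- by move=> i j ij; apply/phiS/psiS.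
- exact: L1posB.
have vcvg' : L1norm (fun x => res (k (phi (psi m)))^\+ x - v x) @[m --> \oo] --> 0%E.
  apply: (cvg_comp psi _ _ vcvg).
  have psi_ge m : (m <= psi m)%N
    by elim: m => // m IH; exact: leq_ltn_trans IH (psiS _ _ (ltnSn m)).
  move=> A [N _ NA]; exists N => // m /= Nm; apply: NA => /=.
  exact: leq_trans Nm (psi_ge m).
apply: (@squeeze_cvge _ _ _ _ (cst 0%E) _
  (fun m => L1norm (fun x => res (k (phi (psi m)))^\+ x - v x)%R +
            L1norm (fun x => res (k (phi (psi m)))^\- x - w x)%R)%E).
- apply: nearW => m; rewrite L1norm_ge0/=.
  have kpL := L1pos_funrpos (kL (phi (psi m))).
  have knL := L1pos_funrneg (kL (phi (psi m))).
  have mB f h : L1pos f -> L1pos h -> measurable_fun setT (fun x => res f x - h x).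
    move=> fL hL; apply: measurable_funB; first exact: (measurable_res wn).
    exact: L1pos_measurable.
  apply: le_trans (L1norm_triangleB (mB _ _ kpL vL) (mB _ _ knL wL)).
  rewrite le_eqVlt; apply/orP; left; apply/eqP; apply: eq_L1norm => x.
  have := res_lin wn 1 (-1) x kpL knL; rewrite mul1r mulN1r.
  have -> : (fun y => 1 * (k (phi (psi m)))^\+ y + -1 * (k (phi (psi m)))^\- y) = k (phi (psi m)).
    by apply/funext => y; rewrite mul1r mulN1r -funr_split.
  by move=> ->; ring.
- exact: cvg_cst.
- by rewrite -(adde0 0%E); apply: cvgeD.
Qed.

End Compactness.

(** * The travel time as a coordinate *)

Record admissible_speed {R : realType} (r : R -> R) (C : R) : Prop := AdmissibleSpeed {
  speed_cont : forall x : R, 0 < x -> {for x, continuous r} ;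
  speed_gt0 : forall x : R, 0 < x -> 0 < r x ;
  speed_int0 : (\int[@lebesgue_measure R]_(tau in `]0%R, 1%R[) ((r tau)^-1)%:E < +oo)%E ;
  speed_cst_gt0 : 0 < C ;
  speed_sublin : forall z : R, 0 < z -> r z <= C * (z + 1) }.

Section Clock.
Context {R : realType}.
Local Notation mu := (@lebesgue_measure R).
Variables (r : R -> R) (C : R).
Hypothesis hr : admissible_speed r C.
Let r_cont := speed_cont hr.
Let r_gt0 := speed_gt0 hr.
Let r_int0 := speed_int0 hr.
Let C_gt0 := speed_cst_gt0 hr.
Let r_le := speed_sublin hr.

Definition slowness : R -> R := (fun x => (r x)^-1) \_ Rpos.
(** Integrating over ]-oo, y] rather than ]0, y] makes [travel] a primitive of
    [slowness] on the whole line. *)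
Definition travel (y : R) : R := \int[mu]_(x in `]-oo, y]) slowness x.
(** The identity on the negative half-line, so that [clock] is a bijection of
    the whole line. *)
Definition clock (y : R) : R := travel y + Num.min y 0.

Lemma slowness_gt0E x : 0 < x -> slowness x = (r x)^-1.
Proof. by move=> x0; rewrite /slowness patchE mem_set// /Rpos/= in_itv/= x0. Qed.

Lemma slowness_le0E x : x <= 0 -> slowness x = 0.
Proof.
by move=> x0; rewrite /slowness patchE memNset// /Rpos/= in_itv/= andbT; apply/negP; rewrite -leNgt.
Qed.

Lemma slowness_ge0 x : 0 <= slowness x.
Proof.
have [/slowness_le0E->//|x0] := leP x 0.
by rewrite slowness_gt0E// invr_ge0 ltW// r_gt0.
Qed.

Lemma rinv_cont x : 0 < x -> {for x, continuous (fun x => (r x)^-1)}.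
Proof. by move=> x0; apply: cvgV; [rewrite gt_eqF// r_gt0|exact: r_cont]. Qed.

Lemma measurable_rinv : measurable_fun Rpos (fun x => (r x)^-1).
Proof.
apply: open_continuous_measurable_fun => // x.
by rewrite inE /Rpos/= in_itv/= andbT; exact: rinv_cont.
Qed.

Lemma measurable_Rpos : measurable (Rpos : set R).
Proof. exact: measurable_itv. Qed.

Lemma measurable_slowness : measurable_fun setT slowness.
Proof. by apply/(measurable_restrictT _ measurable_Rpos); exact: measurable_rinv. Qed.

Lemma slowness_cont x : 0 < x -> {for x, continuous slowness}.
Proof.
move=> x0; have := rinv_cont x0; rewrite /prop_for /continuous_at slowness_gt0E//.
apply: cvg_trans; apply: near_eq_cvg; near=> z; rewrite slowness_gt0E//.
near: z; exact: lt_nbhsr.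
Unshelve. all: by end_near. Qed.

Lemma integrable_slowness y : mu.-integrable `]-oo, y] (EFin \o slowness).
Proof.
have i1 : mu.-integrable `]-oo, 1[ (EFin \o slowness).
  apply/integrableP; split.
    by apply/measurable_EFinP/measurable_funTS; exact: measurable_slowness.
  rewrite (_ : (\int[mu]_(x in _) _)%E = (\int[mu]_(tau in `]0%R, 1%R[) ((r tau)^-1)%:E)%E)//.
  rewrite integral_mkcond [RHS]integral_mkcond; apply: eq_integral => x _.
  rewrite !patchE !mem_setE !in_itv/=.
  have [x0|x0] := leP x 0; first by rewrite slowness_le0E//= normr0 if_same.
  by rewrite slowness_gt0E//= gtr0_norm// invr_gt0 r_gt0.
have [y1|y1] := ltP y 1.
  apply: (@integrableS _ _ _ mu `]-oo, 1[%classic) => // x /=.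
  by rewrite !in_itv/= => /le_lt_trans; apply.
have i2 : mu.-integrable `[1, y] (EFin \o slowness).
  apply: continuous_compact_integrable; first exact: segment_compact.
  apply: continuous_in_subspaceT => x; rewrite inE/= in_itv/= => /andP[x1 _].
  by apply: slowness_cont; exact: lt_le_trans x1.
have -> : `]-oo, y]%classic = `]-oo, 1[%classic `|` `[1, y]%classic.
  by rewrite -itv_bndbnd_setU// bnd_simp.
apply/integrableP; split.
  by apply/measurable_EFinP/measurable_funTS; exact: measurable_slowness.
rewrite ge0_integral_setU//; last 2 first.
  apply: measurableT_comp => //; apply/measurable_EFinP/measurable_funTS.
  exact: measurable_slowness.
  apply/disj_setPS => x []; rewrite /= !in_itv/= => x1 /andP[].
  by rewrite leNgt x1.
by apply: lte_add_pinfty; [case/integrableP : i1|case/integrableP : i2].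
Qed.

Lemma travelB x y : x <= y -> travel y - travel x = \int[mu]_(z in `]x, y]) slowness z.
Proof. by move=> xy; apply: Rintegral_itvB; rewrite ?bnd_simp//; exact: integrable_slowness. Qed.

Lemma travel_le0 y : y <= 0 -> travel y = 0.
Proof.
move=> y0; rewrite /travel (@eq_Rintegral _ _ _ _ _ (fun=> 0)) ?Rintegral_cst ?mul0r//.
by move=> x; rewrite inE/= in_itv/= => xs; rewrite slowness_le0E// (le_trans xs).
Qed.

Lemma clock_ge0E y : 0 <= y -> clock y = travel y.
Proof. by move=> y0; rewrite /clock min_r// addr0. Qed.

Lemma clock_le0E y : y <= 0 -> clock y = y.
Proof. by move=> y0; rewrite /clock min_l// travel_le0// add0r. Qed.

Lemma travel_timeE x y : 0 <= x -> x <= y -> travel_time r x y = (clock y - clock x)%:E.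
Proof.
move=> x0 xy; have y0 := le_trans x0 xy.
rewrite !clock_ge0E// travelB// /travel_time /Rintegral fineK; last first.
  apply: integrable_fin_num => //.
  apply: (@integrableS _ _ _ mu `]-oo, y]%classic) => //; last exact: integrable_slowness.
  by move=> z /=; rewrite !in_itv/= => /andP[].
rewrite -integral_itv_bndo_bndc; last first.
  by apply/measurable_EFinP/measurable_funTS; exact: measurable_slowness.
apply: eq_integral => z; rewrite inE/= in_itv/= => /andP[xz _].
by rewrite slowness_gt0E// (le_lt_trans x0).
Qed.

(** The bound r z <= C (z + 1) gives a lower bound on 1 / r, which makes the clock
    strictly increasing. *)
Lemma clock_gap x y : 0 <= x -> x <= y -> (C * (y + 1))^-1 * (y - x) <= clock y - clock x.
Proof.
move=> x0 xy; have y0 := le_trans x0 xy; rewrite !clock_ge0E// travelB//.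
have -> : (C * (y + 1))^-1 * (y - x) = \int[mu]_(z in `]x, y]) (C * (y + 1))^-1.
  rewrite Rintegral_cst//; congr (_ * _); rewrite /= lebesgue_measure_itv/= lte_fin.
  by case: ltgtP xy => // -> _; rewrite subrr.
apply: le_Rintegral => //.
- apply: (@integrableS _ _ _ mu `[x, y]%classic) => //.
    by move=> z /=; rewrite !in_itv/= => /andP[/ltW -> ->].
  apply: continuous_compact_integrable; first exact: segment_compact.
  by apply: continuous_subspaceT => z; exact: cst_continuous.
- apply: (@integrableS _ _ _ mu `]-oo, y]%classic) => //; last exact: integrable_slowness.
  by move=> z /=; rewrite !in_itv/= => /andP[].
- move=> z /=; rewrite in_itv/= => /andP[xz zy]; have z0 := le_lt_trans x0 xz.
  rewrite slowness_gt0E// lef_pV2 ?posrE ?r_gt0//; last by rewrite mulr_gt0// ltr_wpDl.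
  by apply: (le_trans (r_le z0)); rewrite ler_pM2l// lerD2r.
Qed.

Lemma clock_incr : {homo clock : x y / x < y}.
Proof.
have pos x y : 0 <= x -> x < y -> clock x < clock y.
  move=> x0 xy; rewrite -subr_gt0; apply: lt_le_trans (clock_gap x0 (ltW xy)).
  by rewrite mulr_gt0 ?subr_gt0// invr_gt0 mulr_gt0// ltr_wpDl// (le_trans x0)// ltW.
move=> x y xy; have [x0|x0] := leP 0 x; first exact: pos.
have [y0|y0] := leP y 0; first by rewrite !clock_le0E// ltW.
apply: (@lt_trans _ _ 0); first by rewrite clock_le0E// ltW.
by have := pos 0 y (lexx _) y0; rewrite clock_le0E.
Qed.

Lemma is_derive_travel (x : R) : 0 < x -> is_derive x 1 travel (slowness x).
Proof.
move=> x0; have x1 : x < x + 1 by rewrite ltrDl.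
have [d f'] := continuous_FTC1 x1 (integrable_slowness (x + 1)) (ltNyr _) (slowness_cont x0).
by split; [exact: d|rewrite -derive1E].
Qed.

(** C travel(z) - ln(1 + z) has the nonnegative derivative C / r(z) - 1 / (1 + z). *)
Lemma clock_growth (x y : R) : 0 < x -> x <= y ->
  1 + y <= expR (C * (clock y - clock x)) * (1 + x).
Proof.
move=> x0; rewrite le_eqVlt => /predU1P[<-|xy].
  by rewrite subrr mulr0 expR0 mul1r.
have y0 := lt_trans x0 xy.
have x1 : 0 < 1 + x by rewrite ltr_wpDl.
have y1 : 0 < 1 + y by rewrite ltr_wpDl// ltW.
rewrite (clock_ge0E (ltW y0)) (clock_ge0E (ltW x0)).
pose f z := C * travel z - ln (1 + z).
pose df z := C * slowness z - (1 + z)^-1.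
have fd (z : R) : 0 < z -> is_derive z 1 f (df z).
  move=> z0; have z1 : 0 < 1 + z by rewrite ltr_wpDl// ltW.
  have d1 : is_derive z 1 (fun z => ln (1 + z)) (1 + z)^-1.
    have e1 : is_derive z 1 (fun z : R => 1 + z) 1.
      by have := is_deriveD (is_derive_cst (1 : R) z 1) (is_derive_id z 1); rewrite add0r.
    by have := is_derive1_comp (is_derive1_ln z1) e1; rewrite mulr1.
  have d2 : is_derive z 1 (fun z => C * travel z) (C * slowness z).
    by have := is_deriveZ C (is_derive_travel z0).
  exact: is_deriveB.
have [c] : exists2 c, c \in `]x, y[%R & f y - f x = df c * (y - x).
  apply: MVT => //.
    by move=> z; rewrite in_itv/= => /andP[xz _]; apply: fd; exact: lt_trans xz.
  apply: derivable_within_continuous => z; rewrite in_itv/= => /andP[xz _].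
  by have [] := fd z (lt_le_trans x0 xz).
rewrite in_itv/= => /andP[xc cy] fE; have c0 := lt_trans x0 xc.
(* This is the bound r c <= C (c + 1). *)
have df0 : 0 <= df c.
  have c1 : 0 < 1 + c by rewrite ltr_wpDl// ltW.
  rewrite /df subr_ge0 slowness_gt0E// -[leLHS]mul1r ler_pdivrMr// mulrAC.
  by rewrite ler_pdivlMr ?r_gt0// mul1r [1 + c]addrC r_le.
have : 0 <= f y - f x by rewrite fE mulr_ge0// subr_ge0 ltW.
rewrite /f => h.
have : ln (1 + y) <= C * (travel y - travel x) + ln (1 + x) by lra.
by rewrite -ler_expR expRD (lnK y1) (lnK x1).
Qed.

Lemma travel_continuous (b : R) : {within `[0, b], continuous travel}.
Proof.
have [b0|b0] := ltP b 0.
  by rewrite set_itv_ge ?bnd_simp -?ltNge//; exact: continuous_subspace0.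
have i : mu.-integrable `[0, b] (EFin \o slowness).
  apply: (@integrableS _ _ _ mu `]-oo, b]%classic) => //; last exact: integrable_slowness.
  by move=> z /=; rewrite !in_itv/= => /andP[].
have := parameterized_integral_continuous b0 i.
apply: subspace_eq_continuous => x; rewrite inE /from_subspace/= in_itv/= => /andP[x0 _].
rewrite /parameterized_integral -Rintegral_itv_obnd_cbnd; last first.
  apply: (@integrableS _ _ _ mu `]-oo, x]%classic) => //; last exact: integrable_slowness.
  by move=> z /=; rewrite !in_itv/= => /andP[].
by rewrite -travelB// (travel_le0 (lexx 0)) subr0.
Qed.

(** [clock_growth] makes the clock unbounded; the intermediate value theorem
    does the rest. *)
Lemma clock_surj s : exists y, clock y = s.
Proof.
have [s0|s0] := leP s 0; first by exists s; rewrite clock_le0E.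
(* [clock_growth] at x = 1 gives (1 + b) / 2 <= exp(C clock(b)), whence the factor 2. *)
pose b := expR (C * s) * 2.
have b1 : 1 <= b.
  rewrite /b; have : 1 <= expR (C * s) by rewrite -expR0 ler_expR mulr_ge0// ltW.
  by lra.
have b0 : 0 <= b by rewrite (le_trans _ b1).
have sb : s <= travel b.
  have := clock_growth ltr01 b1; rewrite !clock_ge0E// => h.
  have : expR (C * s) <= expR (C * (travel b - travel 1)).
    rewrite /b in h *; move: h; have := expR_gt0 (C * s); lra.
  rewrite ler_expR ler_pM2l// => /le_trans; apply.
  by rewrite gerBl Rintegral_ge0// => x _; exact: slowness_ge0.
have [||y] := @IVT R travel 0 b s b0.
- exact: travel_continuous.
- by rewrite (travel_le0 (lexx 0)) ge_min (ltW s0) le_max sb orbT.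
- by rewrite in_itv/= => /andP[y0 _] yE; exists y; rewrite clock_ge0E.
Qed.

Definition place (s : R) : R := xget 0 [set y | clock y = s].

Lemma placeK s : clock (place s) = s.
Proof. by have [y yE] := clock_surj s; exact: (xgetI 0 (yE : [set y | clock y = s] y)). Qed.

Lemma clock_inj : injective clock.
Proof.
move=> x y xy; have [/clock_incr|/clock_incr|//] := ltgtP x y; by rewrite xy ltxx.
Qed.

Lemma clockK y : place (clock y) = y.
Proof. by apply: clock_inj; rewrite placeK. Qed.

Lemma clock_le x y : (clock x <= clock y) = (x <= y).
Proof. exact: (le_mono clock_incr). Qed.

Lemma clock_lt x y : (clock x < clock y) = (x < y).
Proof. by rewrite !ltNge clock_le. Qed.

Lemma clock0 : clock 0 = 0.
Proof. exact: clock_le0E. Qed.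

Lemma clock_gt0 y : (0 < clock y) = (0 < y).
Proof. by rewrite -{1}clock0 clock_lt. Qed.

Lemma place_le s t : (place s <= place t) = (s <= t).
Proof. by rewrite -clock_le !placeK. Qed.

Lemma place_gt0 s : (0 < place s) = (0 < s).
Proof. by rewrite -clock_gt0 placeK. Qed.

Lemma measurable_clock : measurable_fun setT clock.
Proof. by apply: nondecreasing_measurable => // x y; rewrite clock_le. Qed.

Lemma measurable_place : measurable_fun setT place.
Proof. by apply: nondecreasing_measurable => // x y; rewrite place_le. Qed.

Lemma flowE y t : 0 < t -> t < clock y -> flow r y t = place (clock y - t).
Proof.
move=> t0 ty; apply: xget_unique.
  split; rewrite ?place_gt0 ?subr_gt0//.
    by rewrite -clock_le placeK gerBl ltW.
  rewrite travel_timeE ?placeK; first by congr EFin; ring.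
    by rewrite ltW// place_gt0 subr_gt0.
  by rewrite -clock_le placeK gerBl ltW.
move=> x [x0 xy]; rewrite travel_timeE ?(ltW x0)// => -[<-].
by rewrite -[LHS]clockK; congr place; ring.
Qed.

(** The derivative of [clock] away from 0. *)
Definition clock_density (y : R) : R := slowness y + \1_(`]-oo, 0]) y.

Lemma measurable_clock_density : measurable_fun setT clock_density.
Proof.
apply: measurable_funD; first exact: measurable_slowness.
by apply: measurable_indic; exact: measurable_itv.
Qed.

Lemma clock_density_ge0 y : 0 <= clock_density y.
Proof. by rewrite addr_ge0 ?slowness_ge0. Qed.

Lemma integral_clock_density x y : x <= y ->
  (\int[mu]_(z in `]x, y]) (clock_density z)%:E = (clock y - clock x)%:E)%E.
Proof.
move=> xy; rewrite /clock_density; under eq_integral do rewrite EFinD.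
have i : mu.-integrable `]x, y] (EFin \o slowness).
  apply: (@integrableS _ _ _ mu `]-oo, y]%classic) => //; last exact: integrable_slowness.
  by move=> z /=; rewrite !in_itv/= => /andP[].
rewrite ge0_integralD//; last 3 first.
- by move=> z _; rewrite lee_fin slowness_ge0.
- by apply/measurable_EFinP/measurable_funTS; exact: measurable_slowness.
- by apply/measurable_EFinP/measurable_funTS/measurable_indic; exact: measurable_itv.
have -> : (\int[mu]_(z in `]x, y]) (slowness z)%:E = (travel y - travel x)%:E)%E.
  by rewrite travelB// /Rintegral fineK//; exact: integrable_fin_num.
rewrite integral_indic//=.
have -> : `]-oo, 0] `&` `]x, y] = `]x, (Num.min y 0)]%classic.
  by apply/seteqP; split=> z /=; rewrite !in_itv/= le_min;
    [move=> [-> /andP[-> ->]]|move=> /andP[-> /andP[-> ->]]].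
rewrite lebesgue_measure_itv/= lte_fin -EFinD /clock.
have [x0|x0] := ltP x (Num.min y 0).
  have x00 : x <= 0 by move: x0; rewrite lt_min => /andP[_ /ltW].
  by rewrite (min_l x00) -EFinD; congr EFin; ring.
rewrite adde0; congr EFin.
have [x00|x00] := leP x 0.
  by have -> : Num.min y 0 = x; [apply/eqP; rewrite eq_le x0 le_min xy|ring].
by rewrite !min_r ?(ltW x00) ?(le_trans (ltW x00) xy)//; ring.
Qed.

Definition clock_measure : {measure set (measurableTypeR R) -> \bar R} :=
  density mu measurable_clock_density clock_density_ge0.

(** Both measures give the interval ]a, b] the mass b - a. *)
Lemma pushforward_clock (A : set R) : measurable A ->
  pushforward clock_measure (clock : _ -> measurableTypeR R) A = mu A.
Proof.
pose phi : measurableTypeR R -> measurableTypeR R := clock.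
pose phi_m := isMeasurableFun.Build _ _ _ _ phi measurable_clock.
pose phi_p : {mfun _ >-> _} := HB.pack phi phi_m.
move=> mA; apply/esym.
apply: (@lebesgue_measure_unique R (pushforward clock_measure phi_p)) => //= _ [[a b]] _ <-.
rewrite /pushforward.
have -> : phi_p @^-1` `]a, b]%classic = `]place a, place b]%classic.
  apply/seteqP; split => x /=; rewrite !in_itv/= -[x in (place a < x) && (x <= _)]clockK.
    by rewrite !ltNge !place_le.
  by rewrite !ltNge !place_le.
rewrite lebesgue_measure_itv/= lte_fin.
have [ab|ba] := ltP a b; last first.
  rewrite set_itv_ge ?bnd_simp -?leNgt ?place_le//.
  by rewrite /density_measure integral_set0.
rewrite [LHS](_ : _ = (clock (place b) - clock (place a))%:E); last by rewrite !placeK.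
by rewrite -integral_clock_density// place_le ltW.
Qed.

Lemma ge0_change_of_variables (G : R -> \bar R) :
  measurable_fun setT G -> (forall x, 0 <= G x)%E ->
  (\int[mu]_x G x = \int[mu]_y (G (clock y) * (clock_density y)%:E))%E.
Proof.
move=> mG G0.
have -> : (\int[mu]_y (G (clock y) * (clock_density y)%:E) =
           \int[clock_measure]_y G (clock y))%E.
  rewrite /clock_measure.
  rewrite (@ge0_integral_density _ _ _ mu _ measurable_clock_density clock_density_ge0
    (G \o clock) (measurableT_comp mG measurable_clock))//.
  by move=> x; exact: G0.
have := @ge0_integral_pushforward _ _ (measurableTypeR R) (measurableTypeR R)
  R _ measurable_clock clock_measure setT G measurableT mG (fun x _ => G0 x).
rewrite preimage_setT => <-.
apply: eq_measure_integral => [|mf A mA _]; first exact: measurable_clock.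
exact/esym/pushforward_clock.
Qed.

End Clock.

(** * Absorption along the characteristics *)

Section Absorption.
Context {R : realType}.
Local Notation mu := (@lebesgue_measure R).
Variables (alpha C : R) (a r : R -> R).
Hypothesis hr : admissible_speed r C.
Hypothesis alpha_gt0 : 0 < alpha.
Hypothesis a_ge0 : forall x : R, 0 < x -> 0 <= a x.
Hypothesis a_loc : locally_integrable Rpos a.
Local Notation clock := (clock r).
Local Notation place := (place r).
Local Notation slowness := (slowness r).

Definition absorption_rate : R -> R := (fun x => a x / r x) \_ Rpos.
(** A signed integral, based at 1 because a / r may fail to be integrable
    at 0. *)
Definition absorption (y : R) : R :=
  if 1 <= y then \int[mu]_(x in `]1, y]) absorption_rate x
  else - \int[mu]_(x in `]y, 1]) absorption_rate x.

Lemma absorption_rate_gt0E x : 0 < x -> absorption_rate x = a x / r x.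
Proof. by move=> x0; rewrite /absorption_rate patchE mem_set// /Rpos/= in_itv/= x0. Qed.

Lemma absorption_rate_ge0 x : 0 <= absorption_rate x.
Proof.
rewrite /absorption_rate patchE; case: ifPn => //.
rewrite inE /Rpos/= in_itv/= andbT => x0.
by rewrite divr_ge0 ?a_ge0// ltW// (speed_gt0 hr).
Qed.

Lemma integrable_absorption_rate x y : 0 < x ->
  mu.-integrable `]x, y] (EFin \o absorption_rate).
Proof.
move=> x0; apply: (@integrableS _ _ _ mu `[x, y]%classic) => //.
  by move=> z /=; rewrite !in_itv/= => /andP[/ltW -> ->].
have xyP z : `[x, y]%classic z -> 0 < z.
  by rewrite /= in_itv/= => /andP[/(lt_le_trans x0)].
have xyR : `[x, y]%classic `<=` Rpos by move=> z /xyP z0; rewrite /Rpos/= in_itv/= z0.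
have cK : compact `[x, y]%classic by exact: segment_compact.
have [ma _ afin] := a_loc.
have ia : mu.-integrable `[x, y] (EFin \o a).
  apply/integrableP; split; last exact: (afin _ xyR cK).
  by apply/measurable_EFinP; apply: (measurable_funS _ xyR ma); exact: measurable_Rpos.
have [M [Mr HM]] : bounded_set ((fun z => (r z)^-1) @` `[x, y]%classic).
  apply: compact_bounded; apply: continuous_compact => //.
  by apply: continuous_in_subspaceT => z; rewrite inE => /xyP; exact: (rinv_cont hr).
have bd : [bounded (r z)^-1 | z in `[x, y]%classic].
  by exists M; split => // N MN z xyz; apply: (HM _ MN); exists z.
have mr : measurable_fun `[x, y] (fun z => (r z)^-1).
  by apply: measurable_funS (measurable_rinv hr) => //; exact: measurable_Rpos.
have := @integrableMr _ _ R mu _ (measurable_itv `[x, y]) (fun z => (r z)^-1) (EFin \o a) mr bd ia.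
apply: eq_integrable => // z; rewrite inE => /xyP z0 /=.
by rewrite absorption_rate_gt0E// -EFinM mulrC.
Qed.

Lemma absorptionB x y : 0 < x -> x <= y ->
  absorption y - absorption x = \int[mu]_(z in `]x, y]) absorption_rate z.
Proof.
move=> x0 xy; rewrite /absorption.
have [x1|x1] := leP 1 x.
  rewrite (le_trans x1 xy); apply: Rintegral_itvB; rewrite ?bnd_simp//.
  exact: integrable_absorption_rate.
have [y1|y1] := leP 1 y.
  rewrite opprK -(@Rintegral_itvB _ _ (BRight x) (BRight y) 1) ?bnd_simp ?(ltW x1)//.
    by rewrite addrNK.
  exact: integrable_absorption_rate.
rewrite opprK addrC -(@Rintegral_itvB _ _ (BRight x) (BRight 1) y) ?bnd_simp ?(ltW y1)//.
  by rewrite subKr.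
exact: integrable_absorption_rate.
Qed.

Lemma absorption_le x y : 0 < x -> x <= y -> absorption x <= absorption y.
Proof.
move=> x0 xy; rewrite -subr_ge0 absorptionB//.
by apply: Rintegral_ge0 => z _; exact: absorption_rate_ge0.
Qed.

Lemma absorption_transport x y : 0 < x -> x <= y ->
  \int[mu]_(p in `]x, y[) (a p / r p) = absorption y - absorption x.
Proof.
move=> x0 xy; rewrite absorptionB// -Rintegral_itv_bndo_bndc; last first.
  apply: (@integrableS _ _ _ mu `]x, y]%classic) => //; last exact: integrable_absorption_rate.
  by move=> z /=; rewrite !in_itv/= => /andP[-> /ltW ->].
apply: eq_Rintegral => z; rewrite inE/= in_itv/= => /andP[xz _].
by rewrite absorption_rate_gt0E// (lt_trans x0).
Qed.

(** a is only measurable on the half-line; cut off outside it, it has Borel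
    sublevel sets in the whole line. *)
Definition low_set (c : R) : set R := [set z | (a \_ Rpos) z < c].
Definition low_slowness (c z : R) : R := \1_(low_set c) z * slowness z.

Lemma measurable_low_slowness c : measurable_fun setT (low_slowness c).
Proof.
apply: measurable_funM; last exact: (measurable_slowness hr).
apply: measurable_indic.
have ma : measurable_fun setT (a \_ Rpos).
  by apply/(measurable_restrictT _ (@measurable_Rpos R)); case: a_loc.
have := ma measurableT _ (measurable_itv `]-oo, c[); rewrite setTI.
by congr measurable; apply/seteqP; split => z; rewrite /low_set /= in_itv.
Qed.

Lemma low_slowness_ge0 c z : 0 <= low_slowness c z.
Proof. by rewrite mulr_ge0 ?(slowness_ge0 hr). Qed.

Lemma low_slowness_le c z : low_slowness c z <= slowness z.
Proof. by rewrite ler_piMl ?(slowness_ge0 hr)// indicE lern1 leq_b1. Qed.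

Lemma integral_low_slowness c :
  (\int[mu]_(y in `]1%R, +oo[) (\1_[set z | a z < c] y * (r y)^-1)%:E =
   \int[mu]_(y in `]1%R, +oo[) (low_slowness c y)%:E)%E.
Proof.
apply: eq_integral => z; rewrite inE/= in_itv/= andbT => z1.
have z0 : 0 < z by rewrite (lt_trans _ z1).
rewrite /low_slowness slowness_gt0E//; congr (_ * _)%:E; rewrite !indicE.
have zR : z \in (Rpos : set R) by rewrite inE /Rpos/= in_itv/= z0.
by congr (nat_of_bool _)%:R; apply/idP/idP; rewrite !inE /low_set/= patchE zR.
Qed.

Lemma coercive_thin : a x @[x --> +oo] --> +oo -> thin_sublevels a r.
Proof.
move=> ainf c c0.
have [A [Areal HA]] : \forall x \near +oo, c <= a x by move/cvgryPge : ainf; exact.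
pose B := Num.max 1 A.
have i : mu.-integrable `]1, B] (EFin \o slowness).
  apply: (@integrableS _ _ _ mu `]-oo, B]%classic) => //; last exact: (integrable_slowness hr).
  by move=> z /=; rewrite !in_itv/= => /andP[].
rewrite integral_low_slowness; case/integrableP : i => _; apply: le_lt_trans.
rewrite integral_mkcond [leRHS]integral_mkcond; apply: ge0_le_integral => //.
- by move=> x _; rewrite patchE; case: ifPn => // _; rewrite lee_fin low_slowness_ge0.
- apply/(measurable_restrictT _ (measurable_itv _))/measurable_EFinP/measurable_funTS.
  exact: measurable_low_slowness.
- apply/(measurable_restrictT _ (measurable_itv _)); apply: measurableT_comp => //.
  by apply/measurable_EFinP/measurable_funTS; exact: (measurable_slowness hr).
- move=> x _; rewrite !patchE; case: ifPn => [|_]; last by case: ifPn => _; rewrite ?abse_ge0.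
  rewrite inE/= in_itv/= andbT => x1; have x0 : 0 < x by rewrite (lt_trans _ x1).
  case: ifPn => xB.
    by rewrite /= lee_fin (le_trans (low_slowness_le c x))// ler_norm.
  rewrite lee_fin /low_slowness indicE memNset ?mul0r//.
  rewrite /low_set/= patchE mem_set /Rpos/= ?in_itv/= ?x0//; apply/negP; rewrite -leNgt.
  apply: HA; move: xB; rewrite mem_setE in_itv/= x1/= -ltNge.
  by rewrite gt_max => /andP[].
Qed.

(** Outside {a < c} the rate a / r is at least c / r, and beyond y0 the set {a < c}
    costs a travel time at most e. *)
Lemma thin_tail (c e : R) : thin_sublevels a r -> 0 < c -> 0 < e ->
  exists y0, 1 <= y0 /\ forall x y, y0 <= x -> x <= y ->
    c * (clock y - clock x) - c * e <= absorption y - absorption x.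
Proof.
move=> thin c0 e0.
pose w := low_slowness c.
have w0 : forall z, 0 <= w z := low_slowness_ge0 c.
have mw : measurable_fun setT w := measurable_low_slowness c.
have wi : mu.-integrable `]1, +oo[ (EFin \o w).
  apply/integrableP; split; first by apply/measurable_EFinP; exact: measurable_funTS.
  have := thin c c0; rewrite integral_low_slowness; apply: le_lt_trans.
  rewrite le_eqVlt; apply/orP; left; apply/eqP.
  by apply: eq_integral => z _ /=; rewrite ger0_norm// w0.
(* The tails of an integrable function tend to 0, by dominated convergence. *)
pose I m := `]1 + m%:R, +oo[%classic : set R.
have cv : (\int[mu]_(x in `]1%R, +oo[) ((w \_ (I m)) x)%:E)%E @[m --> \oo] --> 0%E.
  have [_ _] : [/\ mu.-integrable `]1, +oo[ (cst 0%E),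
     [sequence \int[mu]_(x in `]1%R, +oo[) (`|((w \_ (I m)) x)%:E - 0|)]_m%E @ \oo --> 0%E &
     [sequence \int[mu]_(x in `]1%R, +oo[) ((w \_ (I m)) x)%:E]_m%E @ \oo -->
        (\int[mu]_(x in `]1%R, +oo[) 0)%E].
    apply: (@dominated_convergence _ _ _ mu _ (measurable_itv _) _ _ (EFin \o w)) => //.
    - move=> m; apply/measurable_EFinP; apply: measurable_funTS.
      by apply/(measurable_restrictT _ (measurable_itv _)); exact: measurable_funTS.
    - apply: aeW => x _; apply: cvg_near_cst.
      near=> m; rewrite patchE memNset// /I/= in_itv/= andbT; apply/negP; rewrite -leNgt.
      have : (Num.truncn `|x|).+1%:R <= (m%:R : R).
        by rewrite ler_nat; near: m; exact: nbhs_infty_ge.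
      have := truncnS_gt `|x|; have := ler_norm x; lra.
    - apply: aeW => x m _ /=; rewrite patchE; case: ifPn => _.
        by rewrite lee_fin ger0_norm.
      by rewrite normr0 lee_fin.
  by rewrite integral0.
have [m Hm] : exists m, (\int[mu]_(x in `]1%R, +oo[) ((w \_ (I m)) x)%:E <= e%:E)%E.
  move/fine_cvgP : cv => [fin /cvgrPdist_le/(_ _ e0) h].
  have [N _ HN] := filterI fin h; exists N; have [/= Nfin] := HN N (leqnn N).
  rewrite sub0r normrN => hN; rewrite -(fineK Nfin) lee_fin.
  exact: le_trans (ler_norm _) hN.
exists (1 + m%:R); split; first by rewrite lerDl.
move=> x y xm xy.
have x1 : 1 <= x by rewrite (le_trans _ xm)// lerDl.
have x0 : 0 < x by rewrite (lt_le_trans _ x1).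
have y0 : 0 <= y by rewrite ltW// (lt_le_trans x0).
have isl : mu.-integrable `]x, y] (EFin \o slowness).
  apply: (@integrableS _ _ _ mu `]-oo, y]%classic) => //; last exact: (integrable_slowness hr).
  by move=> z /=; rewrite !in_itv/= => /andP[].
have iw : mu.-integrable `]x, y] (EFin \o w).
  apply: (@integrableS _ _ _ mu `]1, +oo[%classic) => //.
  by move=> z /=; rewrite !in_itv/= andbT => /andP[xz _]; exact: le_lt_trans xz.
have we : \int[mu]_(z in `]x, y]) w z <= e.
  rewrite -lee_fin /Rintegral fineK; last exact: integrable_fin_num.
  apply: le_trans Hm.
  have sub : `]x, y]%classic `<=` `]1, +oo[%classic.
    by move=> z /=; rewrite !in_itv/= andbT => /andP[xz _]; exact: le_lt_trans xz.
  apply: (@le_trans _ _ (\int[mu]_(z in `]x, y]) ((w \_ (I m)) z)%:E)%E).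
    rewrite le_eqVlt; apply/orP; left; apply/eqP; apply: eq_integral => z.
    rewrite inE/= in_itv/= => /andP[xz _]; rewrite patchE mem_set// /I/= in_itv/= andbT.
    exact: le_lt_trans xz.
  apply: ge0_subset_integral => //.
  - apply/measurable_EFinP; apply: measurable_funTS.
    by apply/(measurable_restrictT _ (measurable_itv _)); exact: measurable_funTS.
  - by move=> z _; rewrite lee_fin patchE; case: ifPn.
rewrite absorptionB// !clock_ge0E ?(ltW x0)// (travelB hr)//.
apply: (@le_trans _ _ (c * (\int[mu]_(z in `]x, y]) slowness z - \int[mu]_(z in `]x, y]) w z))).
  by rewrite -mulrBr ler_pM2l// lerB.
rewrite -RintegralB// -RintegralZl//; last exact: (integrableB _ isl iw).
apply: le_Rintegral => //.
- exact: (integrableZl _ _ (integrableB _ isl iw)).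
- exact: integrable_absorption_rate.
- move=> z /=; rewrite in_itv/= => /andP[xz zy]; have z0 := lt_trans x0 xz.
  rewrite absorption_rate_gt0E// /w /low_slowness indicE slowness_gt0E//.
  have rz : 0 <= (r z)^-1 by rewrite invr_ge0 ltW// (speed_gt0 hr).
  have [|zE] := boolP (z \in low_set c).
    by rewrite mul1r subrr mulr0 mulr_ge0// a_ge0.
  rewrite mul0r subr0; apply: ler_wpM2r => //; rewrite leNgt; apply/negP => az.
  move/negP: zE; apply; rewrite inE /low_set/= patchE mem_set// /Rpos/= in_itv/= z0.
Unshelve. all: by end_near. Qed.

End Absorption.

(** * The weight attached to transport with absorption *)

Section Conjugation.
Context {R : realType}.
Local Notation mu := (@lebesgue_measure R).
Variables (alpha C : R) (a r : R -> R).
Hypothesis hr : admissible_speed r C.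
Hypothesis alpha_gt0 : 0 < alpha.
Hypothesis a_ge0 : forall x : R, 0 < x -> 0 <= a x.
Hypothesis a_loc : locally_integrable Rpos a.
Local Notation clock := (clock r).
Local Notation place := (place r).
Local Notation slowness := (slowness r).
Local Notation absorption := (absorption a r).

(** alpha C is the growth rate of the weight (1 + y)^alpha along the flow; the
    additional 1 is the decay rate required by [decaying_weight]. *)
Definition resolvent_rate : R := alpha * C + 1.
Definition clock_weight (s : R) : R :=
  if 0 < s then expR (- (resolvent_rate * s) - absorption (place s)) * (1 + place s) `^ alpha
  else 0.

Lemma weight_ratio s t : 0 < s -> s <= t ->
  clock_weight t <= expR (s - t - (absorption (place t) - absorption (place s))) * clock_weight s.
Proof.
move=> s0 st; have t0 := lt_le_trans s0 st; rewrite /clock_weight s0 t0.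
have ps : 0 < place s by rewrite (place_gt0 hr).
have pt : 0 < place t by rewrite (place_gt0 hr).
have pst : place s <= place t by rewrite (place_le hr).
have := clock_growth hr ps pst; rewrite !(placeK hr) => growth.
have : (1 + place t) `^ alpha <= expR (alpha * (C * (t - s))) * (1 + place s) `^ alpha.
  have ps1 : 0 <= 1 + place s by rewrite addr_ge0// ltW.
  have pt1 : 0 <= 1 + place t by rewrite addr_ge0// ltW.
  rewrite [alpha * _]mulrC expRM -powRM ?expR_ge0//.
  by apply: ge0_ler_powR; rewrite ?nnegrE ?mulr_ge0 ?expR_ge0 ?(ltW alpha_gt0).
move=> h; apply: (le_trans (ler_wpM2l (expR_ge0 _) h)).
have D (x y z : R) : expR x * (expR y * z) = expR (x + y) * z by rewrite expRD mulrA.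
rewrite !D (_ : - (resolvent_rate * t) - absorption (place t) + alpha * (C * (t - s)) =
  s - t - (absorption (place t) - absorption (place s)) +
  (- (resolvent_rate * s) - absorption (place s)))//.
by rewrite /resolvent_rate; ring.
Qed.

Lemma weight_decaying : decaying_weight clock_weight.
Proof.
split.
- by move=> s; rewrite /clock_weight leNgt => /negbTE ->.
- move=> s s0; rewrite /clock_weight s0 mulr_gt0 ?expR_gt0// powR_gt0// ltr_wpDr//.
  by rewrite ltW// (place_gt0 hr).
- move=> s t s0 st; apply: (le_trans (weight_ratio s0 st)).
  have w0 : 0 <= clock_weight s.
    by rewrite /clock_weight s0 mulr_ge0 ?expR_ge0 ?powR_ge0.
  apply: ler_wpM2r => //; rewrite ler_expR gerBl subr_ge0.
  by apply: (absorption_le hr a_ge0 a_loc); rewrite ?(place_gt0 hr) ?(place_le hr).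
Qed.

(** With c = exp(1) / e, starting points x beyond the time of y0 use
    [thin_tail], with allowance 1 / c: n(s) / n(x) <= exp(1 - (1 + c) (s - x)),
    of integral exp(1) / (1 + c) <= e.  Earlier starting points use the plain decay
    exp(-(s - x)), and the choice of N makes the integral beyond N at most e. *)
Lemma weight_tail : thin_sublevels a r ->
  forall e, 0 < e -> exists N, forall x : R, 0 < x ->
  (\int[mu]_(s in `]N, +oo[ `&` `[x, +oo[) (clock_weight s / clock_weight x)%:E <= e%:E)%E.
Proof.
move=> thin e e0; pose c := expR 1 / e.
have c0 : 0 < c by rewrite divr_gt0 ?expR_gt0.
have cV0 : 0 < c^-1 by rewrite invr_gt0.
have [y0 [y01 Hy0]] := thin_tail hr a_ge0 a_loc thin c0 cV0.
have y00 : 0 < y0 by rewrite (lt_le_trans _ y01).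
have wd := weight_decaying.
have mw : measurable_fun setT (fun s => (clock_weight s)) := measurable_weight wd.
have mratio x (D : set R) : measurable_fun D (fun s => (clock_weight s / clock_weight x)%:E).
  by apply/measurable_EFinP; apply: measurable_funTS; exact: measurable_funM.
have mexp (d x : R) (D : set R) : measurable_fun D (fun s => (expR (- (d * (s - x))))%:E).
  apply/measurable_EFinP; apply: measurable_funTS.
  apply: measurableT_comp => //; apply: measurableT_comp => //.
  by apply: measurable_funM => //; exact: measurable_funB.
have ratio0 x s : (0 <= (clock_weight s / clock_weight x)%:E)%E.
  by rewrite lee_fin divr_ge0 ?(weight_ge0 wd).
(* The integral of exp(-(s - clock y0)) beyond this point is exactly e. *)
exists (clock y0 - ln e) => x x0.
have wx := weight_gt0 wd x0.
have mI : measurable (`](clock y0 - ln e), +oo[ `&` `[x, +oo[ : set R).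
  by apply: measurableI; exact: measurable_itv.
have [xy|xy] := leP (clock y0) x.
  have c1 : 0 < 1 + c by rewrite ltr_wpDl.
  apply: (@le_trans _ _ (\int[mu]_(s in `[x, +oo[) (expR 1 * expR (- ((1 + c) * (s - x))))%:E)%E).
    apply: (@le_trans _ _ (\int[mu]_(s in `[x, +oo[) (clock_weight s / clock_weight x)%:E)%E).
      apply: ge0_subset_integral; [exact: mI|exact: measurable_itv|
        exact: mratio|by []|exact: subIsetr].
    apply: ge0_le_integral => //.
    - exact: mratio.
    - apply/measurable_EFinP; apply: measurable_funM => //.
      by apply/measurable_EFinP; exact: mexp.
    - move=> s /=; rewrite in_itv/= andbT => xs; rewrite lee_fin ler_pdivrMr//.
      apply: (le_trans (weight_ratio x0 xs)).
      apply: ler_wpM2r; first exact: ltW.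
      rewrite -expRD ler_expR.
      have h1 : y0 <= place x by rewrite -(clock_le hr) (placeK hr).
      have h2 : place x <= place s by rewrite (place_le hr).
      have := Hy0 _ _ h1 h2; rewrite !(placeK hr) divff ?gt_eqF//; lra.
  under eq_integral do rewrite EFinM.
  rewrite ge0_integralZl//; last exact: mexp.
  rewrite integral_exp_tail// -EFinM lee_fin ler_pdivrMr//.
  rewrite mulrDr mulr1 /c mulrC divfK ?gt_eqF//; lra.
apply: (@le_trans _ _ (\int[mu]_(s in `[(clock y0 - ln e)%R, +oo[)
    (e * expR (- (1 * (s - (clock y0 - ln e)))))%:E)%E).
  rewrite integral_mkcond [leRHS]integral_mkcond; apply: ge0_le_integral => //.
  - by move=> s _; rewrite patchE; case: ifPn.
  - by apply/(measurable_restrictT _ mI); exact: mratio.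
  - apply/(measurable_restrictT _ (measurable_itv _)).
    apply/measurable_EFinP; apply: measurable_funM => //.
    by apply/measurable_EFinP; exact: mexp.
  - move=> s _; rewrite !patchE; case: ifPn => [|_]; last first.
      by case: ifPn => // _; rewrite lee_fin mulr_ge0 ?expR_ge0 ?ltW.
    rewrite inE/= !in_itv/= !andbT => -[Ns xs]; rewrite mem_set/= ?in_itv/= ?andbT ?(ltW Ns)//.
    rewrite lee_fin ler_pdivrMr//.
    apply: (le_trans (weight_decay wd x0 xs)); apply: ler_wpM2r; first exact: ltW.
    have -> : e * expR (- (1 * (s - (clock y0 - ln e)))) = expR (clock y0 - s).
      by rewrite -{1}(lnK (e0 : e \in Num.pos)) -expRD; congr expR; ring.
    by rewrite ler_expR; lra.
under eq_integral do rewrite EFinM.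
rewrite ge0_integralZl//; last 2 first.
- exact: mexp.
- by rewrite lee_fin ltW.
by rewrite integral_exp_tail// invr1 mule1.
Qed.

End Conjugation.

(** * Conjugating transport to a weighted translation *)

Section Transfer.
Context {R : realType}.
Local Notation mu := (@lebesgue_measure R).
Variables (alpha C : R) (a r : R -> R).
Hypothesis hr : admissible_speed r C.
Hypothesis alpha_gt0 : 0 < alpha.
Hypothesis a_ge0 : forall x : R, 0 < x -> 0 <= a x.
Hypothesis a_loc : locally_integrable Rpos a.
Implicit Types f g k : R -> R.
Local Notation clock := (clock r).
Local Notation place := (place r).
Local Notation slowness := (slowness r).
Local Notation absorption := (absorption a r).
Local Notation rate := (resolvent_rate alpha C).
Local Notation weight := (clock_weight alpha C a r).
Local Notation U := (transport_semigroup a r).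
Let wd : decaying_weight weight := weight_decaying hr alpha_gt0 a_ge0 a_loc.

(** The isomorphism of X_{0,alpha} onto L^1(0, oo): the variable becomes the
    travel time, r is the Jacobian of [place], and (1 + y)^alpha absorbs the weight of
    the norm. *)
Definition to_clock f (s : R) : R :=
  ((fun y => f y * r y * (1 + y) `^ alpha) \_ Rpos) (place s).
Definition of_clock k (y : R) : R := k (clock y) * (r y)^-1 * (1 + y) `^ (- alpha).

Lemma to_clock_gt0E f s : 0 < s ->
  to_clock f s = f (place s) * r (place s) * (1 + place s) `^ alpha.
Proof.
by move=> s0; rewrite /to_clock patchE mem_set// /Rpos/= in_itv/= (place_gt0 hr) s0.
Qed.

Lemma to_clock_le0E f s : s <= 0 -> to_clock f s = 0.
Proof.
move=> s0; rewrite /to_clock patchE memNset// /Rpos/= in_itv/= andbT (place_gt0 hr).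
by apply/negP; rewrite -leNgt.
Qed.

Lemma to_clock_clock f y : 0 < y -> to_clock f (clock y) = f y * r y * (1 + y) `^ alpha.
Proof. by move=> y0; rewrite to_clock_gt0E ?(clock_gt0 hr)// !(clockK hr). Qed.

Lemma wt_gt0 y : 0 < y -> 0 < (1 + y) `^ alpha.
Proof. by move=> y0; rewrite powR_gt0// ltr_wpDr// ltW. Qed.

Lemma of_clockK k s : (forall x, x <= 0 -> k x = 0) -> to_clock (of_clock k) s = k s.
Proof.
move=> k0; have [s0|s0] := leP s 0; first by rewrite to_clock_le0E// k0.
rewrite to_clock_gt0E// /of_clock (placeK hr) powRN.
have p0 : 0 < place s by rewrite (place_gt0 hr).
have := wt_gt0 p0; have := speed_gt0 hr p0 => r0 w0.
by field; rewrite !gt_eqF.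
Qed.

Lemma to_clockK f y : 0 < y -> of_clock (to_clock f) y = f y.
Proof.
move=> y0; rewrite /of_clock to_clock_clock// powRN.
have := wt_gt0 y0; have := speed_gt0 hr y0 => r0 w0.
by field; rewrite !gt_eqF.
Qed.

Lemma measurable_wt (p : R) : measurable_fun [set: R] (fun y => (1 + y) `^ p).
Proof. by apply: (measurableT_comp (measurable_powR p)); exact: measurable_funD. Qed.

Lemma measurable_speed : measurable_fun Rpos r.
Proof.
apply: open_continuous_measurable_fun => // x.
by rewrite inE /Rpos/= in_itv/= andbT; exact: (speed_cont hr).
Qed.

Lemma measurable_to_clock f : measurable_fun Rpos f -> measurable_fun setT (to_clock f).
Proof.
move=> mf; apply: (measurableT_comp _ (measurable_place hr)).
apply/(measurable_restrictT _ (@measurable_Rpos R)).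
apply: measurable_funM; first by apply: measurable_funM => //; exact: measurable_speed.
by apply: measurable_funTS; exact: measurable_wt.
Qed.

Lemma measurable_of_clock k : measurable_fun setT k -> measurable_fun Rpos (of_clock k).
Proof.
move=> mk; apply: measurable_funM; last by apply: measurable_funTS; exact: measurable_wt.
apply: measurable_funM; last exact: (measurable_rinv hr).
by apply: measurable_funTS; exact: (measurableT_comp mk (measurable_clock hr)).
Qed.

Lemma measurable_of_to_clock f : measurable_fun setT (to_clock f) -> measurable_fun Rpos f.
Proof.
move=> /measurable_of_clock; apply: eq_measurable_fun => y.
by rewrite inE /Rpos/= in_itv/= andbT => y0; rewrite to_clockK.
Qed.

Lemma L1norm_to_clock f : measurable_fun Rpos f -> L1norm (to_clock f) = normX alpha f.
Proof.
move=> mf; have mp := measurable_to_clock mf.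
rewrite /L1norm (ge0_change_of_variables hr (G := fun s => (`|to_clock f s|)%:E))//; last first.
  by apply/measurable_EFinP; exact: measurableT_comp.
rewrite /normX [RHS]integral_mkcond; apply: eq_integral => y _.
rewrite patchE; case: ifPn; rewrite ?inE /Rpos/= ?mem_setE in_itv/= andbT => y0.
  rewrite to_clock_clock// /clock_density slowness_gt0E// indicE memNset; last first.
    by rewrite /= in_itv/=; apply/negP; rewrite -ltNge.
  have r0 := speed_gt0 hr y0; have w0 := wt_gt0 y0.
  rewrite addr0 -EFinM !normrM (gtr0_norm r0) (gtr0_norm w0); congr EFin.
  by field; rewrite gt_eqF.
by rewrite to_clock_le0E ?normr0 ?mul0e// clock_le0E leNgt.
Qed.

Lemma inX_measurable f : inX alpha f -> measurable_fun Rpos f.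
Proof.
move=> /measurable_int/measurable_EFinP m.
have : measurable_fun Rpos (fun y => (f y * (1 + y) `^ alpha) * (1 + y) `^ (- alpha)).
  by apply: measurable_funM => //; apply: measurable_funTS; exact: measurable_wt.
apply: eq_measurable_fun => y; rewrite inE /Rpos/= in_itv/= andbT => y0.
by rewrite powRN mulfK// gt_eqF// wt_gt0.
Qed.

Lemma inX_normE f : measurable_fun Rpos f ->
  inX alpha f <-> (normX alpha f < +oo)%E.
Proof.
move=> mf.
have E : normX alpha f = (\int[mu]_(x in Rpos) `|(f x * (1 + x) `^ alpha)%:E|)%E.
  apply: eq_integral => x _ /=; rewrite normrM; congr (_ * _)%:E.
  by rewrite ger0_norm// powR_ge0.
rewrite E; split; first by case/integrableP.
move=> fin; apply/integrableP; split => //; apply/measurable_EFinP.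
by apply: measurable_funM => //; apply: measurable_funTS; exact: measurable_wt.
Qed.

Lemma L1pos_to_clock f : inX alpha f -> L1pos (to_clock f).
Proof.
move=> fX; have mf := inX_measurable fX; apply: L1posI.
- exact: measurable_to_clock.
- by move=> x; exact: to_clock_le0E.
- by rewrite L1norm_to_clock//; apply/inX_normE.
Qed.

Lemma inX_of_clock k : L1pos k -> inX alpha (of_clock k).
Proof.
move=> kL; have mk := measurable_of_clock (L1pos_measurable kL).
apply/inX_normE => //; rewrite -L1norm_to_clock//.
by rewrite (eq_L1norm (fun s => of_clockK s kL.2)); exact: L1norm_lty.
Qed.

Lemma to_clock_lin f g c d s :
  to_clock (fun y => c * f y + d * g y) s = c * to_clock f s + d * to_clock g s.
Proof.
have [s0|s0] := leP s 0; first by rewrite !to_clock_le0E// !mulr0 addr0.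
by rewrite !to_clock_gt0E//; ring.
Qed.

Lemma shift_algebra (g e1 e2 e3 p F q w1 w2 : R) :
  g * e1 = e2 * e3 -> e3 != 0 -> p != 0 -> w2 != 0 ->
  e2 * (q * F / p) * p * w1 = g * (e1 * w1 / (e3 * w2)) * (F * q * w2).
Proof.
move=> E e30 p0 w20.
have -> : g * (e1 * w1 / (e3 * w2)) * (F * q * w2) = g * e1 / e3 * (w1 * F * q).
  by field; rewrite e30 w20.
by rewrite E; field; rewrite e30 p0.
Qed.

(** The factor of the transport semigroup telescopes: it is a quotient of values
    of the same function n at s and at s - t. *)
Lemma to_clock_transport f t s : 0 < t ->
  to_clock (U t f) s = weighted_shift rate weight t (to_clock f) s.
Proof.
move=> t0; rewrite /weighted_shift.
have [s0|s0] := leP s 0.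
  by rewrite to_clock_le0E// (weight_le0 wd s0) mul0r mulr0 mul0r.
have p0 : 0 < place s by rewrite (place_gt0 hr).
rewrite [LHS]to_clock_gt0E// /transport_semigroup.
rewrite (travel_timeE hr (lexx 0) (ltW p0)) (clock0 r) subr0 (placeK hr) lte_fin.
case: ifPn => [ts|]; last first.
  by rewrite -leNgt => st; rewrite to_clock_le0E ?subr_le0// !mul0r mulr0.
have st0 : 0 < s - t by rewrite subr_gt0.
have q0 : 0 < place (s - t) by rewrite (place_gt0 hr).
have qs : place (s - t) <= place s by rewrite (place_le hr) gerBl ltW.
rewrite (flowE hr t0) ?(placeK hr)// (absorption_transport hr a_loc q0 qs).
rewrite to_clock_gt0E// /clock_weight s0 st0.
have r1 := speed_gt0 hr p0; have w1 := wt_gt0 p0; have w2 := wt_gt0 q0.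
have E : expR (rate * t) * expR (- (rate * s) - absorption (place s)) =
    expR (- (absorption (place s) - absorption (place (s - t)))) *
    expR (- (rate * (s - t)) - absorption (place (s - t))).
  by rewrite -!expRD; congr expR; ring.
by apply: (shift_algebra _ _ _ E); rewrite gt_eqF ?expR_gt0.
Qed.

End Transfer.

(** * The resolvent of the transport generator *)

Section CompactResolvent.
Context {R : realType}.
Local Notation mu := (@lebesgue_measure R).
Variables (alpha C : R) (a r : R -> R).
Hypothesis hr : admissible_speed r C.
Hypothesis alpha_gt0 : 0 < alpha.
Hypothesis a_ge0 : forall x : R, 0 < x -> 0 <= a x.
Hypothesis a_loc : locally_integrable Rpos a.
Implicit Types f g k : R -> R.
Local Notation rate := (resolvent_rate alpha C).
Local Notation weight := (clock_weight alpha C a r).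
Local Notation res := (shift_resolvent weight).
Local Notation phi := (to_clock alpha r).
Local Notation psi := (of_clock alpha r).
Local Notation U := (transport_semigroup a r).
Local Notation G := (generator alpha U).
Let wd : decaying_weight weight := weight_decaying hr alpha_gt0 a_ge0 a_loc.

Lemma to_clockB f g s : phi (fun y => f y - g y) s = phi f s - phi g s.
Proof.
have := to_clock_lin alpha hr f g 1 (-1) s; rewrite mul1r mulN1r => <-.
by congr (to_clock _ _ _ s); apply/funext => y; rewrite mul1r mulN1r.
Qed.

Lemma to_clock_scaleB f g c s : phi (fun y => c * f y - g y) s = c * phi f s - phi g s.
Proof.
have := to_clock_lin alpha hr f g c (-1) s; rewrite mulN1r => <-.
by congr (to_clock _ _ _ s); apply/funext => y; rewrite mulN1r.
Qed.

Lemma norm_slope f g t : 0 < t -> inX alpha f -> inX alpha g ->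
  normX alpha (fun y => t^-1 * (U t f y - f y) - g y) =
  L1norm (fun s => t^-1 * (weighted_shift rate weight t (phi f) s - phi f s) - phi g s).
Proof.
move=> t0 fX gX; have fL := L1pos_to_clock hr fX; have gL := L1pos_to_clock hr gX.
have E s : phi (fun y => t^-1 * (U t f y - f y) - g y) s =
    t^-1 * (weighted_shift rate weight t (phi f) s - phi f s) - phi g s.
  by rewrite to_clock_scaleB to_clockB (to_clock_transport hr alpha_gt0 a_ge0 a_loc).
rewrite -(eq_L1norm E) (L1norm_to_clock alpha hr)//.
apply: (measurable_of_to_clock hr (alpha := alpha)).
rewrite (funext E); apply: L1pos_measurable; apply: L1posB => //.
by apply: L1posZ; apply: L1posB => //; exact: (L1pos_trans rate wd).
Qed.

(** A right limit at 0 is tested on sequences of positive times, to which the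
    convergence theorems of integration apply. *)
Lemma generatorE f g : inX alpha f -> inX alpha g ->
  G f g <-> forall u : nat -> R, (forall m, 0 < u m) -> u m @[m --> \oo] --> 0 ->
    L1norm (fun s => (u m)^-1 * (weighted_shift rate weight (u m) (phi f) s - phi f s) - phi g s)
      @[m --> \oo] --> 0%E.
Proof.
move=> fX gX; split.
  move=> [_ _ /cvge_at_rightP H] u u0 ucvg.
  under eq_fun do rewrite -norm_slope//.
  exact: (H u).
move=> H; split => //; apply/cvge_at_rightP => u [u0 ucvg].
under eq_fun do rewrite norm_slope//.
exact: H.
Qed.

(** [shift_resolvent] in the original variable. *)
Definition explicit_resolvent f : R -> R := psi (res (phi f)).

Lemma to_clock_resolvent f : inX alpha f -> phi (explicit_resolvent f) = res (phi f).
Proof.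
move=> fX; apply/funext => s; apply: (of_clockK alpha hr).
exact: (L1pos_res wd (L1pos_to_clock hr fX)).2.
Qed.

Lemma inX_resolvent f : inX alpha f -> inX alpha (explicit_resolvent f).
Proof.
move=> fX; apply: (inX_of_clock alpha hr).
by apply: L1pos_res => //; exact: (L1pos_to_clock hr).
Qed.

Lemma inX_of_to_clock f : L1pos (phi f) -> inX alpha f.
Proof.
move=> fL; have mf := measurable_of_to_clock hr (L1pos_measurable fL).
by apply/inX_normE => //; rewrite -(L1norm_to_clock alpha hr)//; exact: L1norm_lty.
Qed.

Lemma inX_scaleB f g c : inX alpha f -> inX alpha g -> inX alpha (fun y => c * f y - g y).
Proof.
move=> fX gX; apply: inX_of_to_clock; rewrite (funext (to_clock_scaleB f g c)).
by apply: L1posB; [apply: L1posZ|]; exact: (L1pos_to_clock hr).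
Qed.

Lemma resolvent_graph_resolvent f : inX alpha f ->
  resolvent_graph alpha G rate f (explicit_resolvent f).
Proof.
move=> fX; split => //; have rX := inX_resolvent fX.
apply/generatorE => //; first exact: inX_scaleB.
move=> u u0 ucvg; rewrite to_clock_resolvent// (funext (to_clock_scaleB _ _ _)).
rewrite to_clock_resolvent//.
exact: (gen_res rate wd (L1pos_to_clock hr fX)).
Qed.

Lemma resolvent_graph_unique f v : resolvent_graph alpha G rate f v ->
  L1norm (fun s => phi v s - res (phi f) s) = 0%E.
Proof.
move=> [fX Gv]; have [vX gX _] := Gv.
apply: (gen_unique (lam := rate) wd (L1pos_to_clock hr vX) (L1pos_to_clock hr fX)
  (u := fun m => m.+1%:R^-1)).
- by move=> m; rewrite invr_gt0.
- exact: cvg_harmonic.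
move/(generatorE vX gX) : Gv => /(_ (fun m => m.+1%:R^-1)).
rewrite (funext (to_clock_scaleB v f rate)); apply; last exact: cvg_harmonic.
by move=> m; rewrite invr_gt0.
Qed.

Lemma resolvent_graph_norm f v : resolvent_graph alpha G rate f v ->
  (normX alpha v <= normX alpha f)%E.
Proof.
move=> fv; have [fX [vX _ _]] := fv.
have fL := L1pos_to_clock hr fX; have vL := L1pos_to_clock hr vX.
rewrite -(L1norm_to_clock alpha hr (inX_measurable vX)).
rewrite -(L1norm_to_clock alpha hr (inX_measurable fX)).
have -> : phi v = fun s => (phi v s - res (phi f) s) + res (phi f) s.
  by apply/funext => s; rewrite subrK.
have rL := L1pos_res wd fL.
apply: (le_trans (L1norm_triangle (L1pos_measurable (L1posB vL rL)) (L1pos_measurable rL))).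
by rewrite (resolvent_graph_unique fv) add0e; exact: res_norm.
Qed.

Lemma normX0_eq f g : inX alpha f -> inX alpha g ->
  L1norm (fun s => phi f s - phi g s) = 0%E -> eqX f g.
Proof.
move=> fX gX.
have dX : inX alpha (fun y => f y - g y).
  have := inX_scaleB 1 fX gX; congr inX.
  by apply/funext => y; rewrite mul1r.
rewrite -(eq_L1norm (to_clockB f g)) (L1norm_to_clock alpha hr (inX_measurable dX)) => n0.
have md := measurable_int _ dX.
have : (\int[mu]_(x in Rpos) `|((f x - g x) * (1 + x) `^ alpha)%:E| = 0)%E.
  rewrite -[RHS]n0; apply: eq_integral => x _ /=; rewrite normrM; congr (_ * _)%:E.
  by rewrite ger0_norm// powR_ge0.
move=> /(ae_eq_integral_abs mu (@measurable_Rpos R) md).1; rewrite /eqX /ae_eq.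
apply: filterS => x /= + x0 => /(_ x0) [] /eqP.
rewrite mulf_eq0 [_ `^ _ == 0]gt_eqF ?orbF; last first.
  by apply: wt_gt0; move: x0; rewrite /Rpos/= in_itv/= andbT.
by rewrite subr_eq0 => /eqP.
Qed.

Lemma rate_resolvent_set : resolvent_set alpha G rate.
Proof.
split.
- by move=> f fX; exists (explicit_resolvent f); exact: resolvent_graph_resolvent.
- move=> f u v fu fv; have [fX [uX _ _]] := fu; have [_ [vX _ _]] := fv.
  have fL := L1pos_to_clock hr fX; have uL := L1pos_to_clock hr uX; have vL := L1pos_to_clock hr vX.
  have rL := L1pos_res wd fL.
  apply: normX0_eq => //; apply/eqP; rewrite eq_le L1norm_ge0 andbT.
  rewrite (_ : L1norm _ = L1norm (fun s => (phi u s - res (phi f) s) - (phi v s - res (phi f) s))).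
    apply: (le_trans (L1norm_triangleB (L1pos_measurable (L1posB uL rL))
      (L1pos_measurable (L1posB vL rL)))).
    by rewrite (resolvent_graph_unique fu) (resolvent_graph_unique fv) adde0.
  by apply: eq_L1norm => s; ring.
- exists 1 => f u fu; rewrite mul1e; exact: resolvent_graph_norm.
Qed.

Hypothesis thin : thin_sublevels a r.

Lemma rate_compact : compact_operator alpha (resolvent_graph alpha G rate).
Proof.
move=> f u M fM fu.
have fL m := L1pos_to_clock hr (fM m).1.
have fN m : (L1norm (phi (f m)) <= M%:E)%E.
  by rewrite (L1norm_to_clock alpha hr (inX_measurable (fM m).1)); exact: (fM m).2.
have uX m : inX alpha (u m) by have [_ []] := fu m.
have [e [v [eS vL vcvg]]] := res_compact wd
  (weight_tail hr alpha_gt0 a_ge0 a_loc thin) fL fN.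
exists e, (psi v); have vX := inX_of_clock alpha hr vL.
split => //; apply: cvg_trans vcvg; apply: near_eq_cvg; apply: nearW => m /=.
have mm : measurable_fun Rpos (u (e m) \- psi v).
  by apply: measurable_funB; [exact: inX_measurable (uX _)|exact: inX_measurable vX].
rewrite -(L1norm_to_clock alpha hr mm).
have E s : phi (u (e m) \- psi v) s = phi (u (e m)) s - v s.
  by rewrite to_clockB (of_clockK alpha hr s vL.2).
rewrite (eq_L1norm E).
have uL := L1pos_to_clock hr (uX (e m)); have rL := L1pos_res wd (fL (e m)).
have z := resolvent_graph_unique (fu (e m)).
apply/eqP; rewrite eq_le; apply/andP; split.
  rewrite (_ : (fun s => res (phi (f (e m))) s - v s) =
      fun s => (phi (u (e m)) s - v s) - (phi (u (e m)) s - res (phi (f (e m))) s)); last first.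
    by apply/funext => s; ring.
  apply: (le_trans (L1norm_triangleB (L1pos_measurable (L1posB uL vL))
    (L1pos_measurable (L1posB uL rL)))).
  by rewrite z adde0.
rewrite (_ : (fun s => phi (u (e m)) s - v s) =
    fun s => (res (phi (f (e m))) s - v s) + (phi (u (e m)) s - res (phi (f (e m))) s)); last first.
  by apply/funext => s; ring.
apply: (le_trans (L1norm_triangle (L1pos_measurable (L1posB rL vL))
  (L1pos_measurable (L1posB uL rL)))).
by rewrite z adde0.
Qed.

(** The resolvent equation transfers compactness from [resolvent_rate] to any
    other point of the resolvent set. *)
Lemma thin_compact_resolvent : compact_resolvent alpha G.
Proof.
split; first by exists rate; exact: rate_resolvent_set.
move=> lam [_ _ [B HB]] f u M fM fu.
have uX m : inX alpha (u m) by have [_ []] := fu m.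
have fX m := (fM m).1.
(* f' = f + (rate - lam) u, written in the form covered by the linearity lemmas. *)
pose f' m := fun y => (rate - lam) * u m y - (- f m y).
have f'E m s : phi (f' m) s = (rate - lam) * phi (u m) s + phi (f m) s.
  have := to_clock_lin alpha hr (u m) (f m) (rate - lam) 1 s; rewrite mul1r => <-.
  by congr (to_clock _ _ _ s); apply/funext => y; rewrite /f' mul1r opprK.
have uL m := L1pos_to_clock hr (uX m); have fL m := L1pos_to_clock hr (fX m).
have f'L m : L1pos (phi (f' m)).
  by rewrite (funext (f'E m)); apply: L1posD => //; exact: L1posZ.
have f'X m : inX alpha (f' m) by exact: inX_of_to_clock.
have uM m : (normX alpha (u m) <= (`|B| * M)%:E)%E.
  apply: (le_trans (HB _ _ (fu m))); rewrite EFinM.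
  have n0 : (0 <= normX alpha (f m))%E.
    by rewrite -(L1norm_to_clock alpha hr (inX_measurable (fX m))) L1norm_ge0.
  apply: (@le_trans _ _ (`|B|%:E * normX alpha (f m))%E).
    by apply: lee_wpmul2r => //; rewrite lee_fin ler_norm.
  by apply: lee_wpmul2l; [rewrite lee_fin|exact: (fM m).2].
apply: (rate_compact (f := f') (M := `|rate - lam| * (`|B| * M) + M)).
  move=> m; split => //; rewrite -(L1norm_to_clock alpha hr (inX_measurable (f'X m))).
  rewrite (funext (f'E m)).
  apply: le_trans (L1norm_triangle _ _) _.
  - exact: L1pos_measurable (L1posZ _ (uL m)).
  - exact: L1pos_measurable.
  rewrite L1normZ; last exact: L1pos_measurable.
  rewrite EFinD EFinM (L1norm_to_clock alpha hr (inX_measurable (uX m))).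
  rewrite (L1norm_to_clock alpha hr (inX_measurable (fX m))).
  by apply: leeD; [apply: lee_wpmul2l; rewrite ?lee_fin//; exact: uM|exact: (fM m).2].
move=> m; split => //; have [_ Gu] := fu m.
have -> : (fun x => rate * u m x - f' m x) = (fun x => lam * u m x - f m x) => //.
by apply/funext => x; rewrite /f'; ring.
Qed.

End CompactResolvent.

Theorem theorem3p6 (R : realType) (alpha : R) (a r : R -> R)
  (alpha_gt0 : 0 < alpha)
  (a_ge0 : forall x : R, 0 < x -> 0 <= a x)
  (a_loc : locally_integrable Rpos a)
  (r_cont : forall x : R, 0 < x -> {for x, continuous r})
  (r_gt0 : forall x : R, 0 < x -> 0 < r x)
  (r_int0 : (\int[@lebesgue_measure R]_(tau in `]0%R, 1%R[)
               ((r tau)^-1)%:E < +oo)%E)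
  (r_inty : (\int[@lebesgue_measure R]_(tau in `]1%R, +oo[)
               ((r tau)^-1)%:E = +oo)%E)
  (r_sublin : exists2 C : R, 0 < C & forall z : R, 0 < z -> r z <= C * (z + 1)) :
  (thin_sublevels a r ->
     compact_resolvent alpha (generator alpha (transport_semigroup a r)))
  /\ (a x @[x --> +oo] --> +oo -> thin_sublevels a r).
Proof.
have [C C0 rC] := r_sublin.
have hr : admissible_speed r C by split.
split; last exact: (coercive_thin hr a_loc).
exact: (thin_compact_resolvent hr alpha_gt0 a_ge0 a_loc).
Qed.
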